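(* Almost surely, for any positive even integer $\ell$, any $p>1$ and any potential $a\in L^p(\mathcal S)$, the semilinear problem $$-Hu+au=u|u|^\ell$$ has infinitely many weak solutions.
   Context: $(\mathcal S,g)$ is a closed (compact, connected, boundaryless) two-dimensional Riemannian manifold; all integrals are with respect to the Riemannian volume measure. $\xi$ is a spatial white noise on $\mathcal S$: a random distribution with centered Gaussian law and covariance $\mathbb E[\xi(f_1)\xi(f_2)]=\int_{\mathcal S}f_1f_2$ for smooth real-valued $f_1,f_2$. $H$ is the Anderson operator, formally $Hu=\Delta u+\xi u$, rigorously constructed (by paracontrolled calculus or regularity structures) as a random unbounded operator on $L^2(\mathcal S)$. Statements hold almost surely, i.e. for a fixed realization of $\xi$ outside a null set. The following facts about $H$ are taken as known. (i) $H$ is a closed symmetric unbounded operator on $L^2(\mathcal S)$ with (random) domain $\mathfrak D(H)$ and compact resolvent, and $H:\mathfrak D(H)\to L^2(\mathcal S)$ is almost surely invertible. (ii) There is a random constant $c$, fixed throughout, such that the quadratic form of $-H_c:=-H+c$ is positive definite. The closure of $\mathfrak D(H)$ for the norm $\|u\|_{\mathscr E}:=\sqrt{\langle(-H+c)u,u\rangle_{L^2}}$ is a Hilbert space $\mathscr E$ which is included and dense in the Sobolev space $H^\beta(\mathcal S)$, with compact inclusion, for every $0\le\beta<1$; hence $\mathscr E$ is compactly embedded in $L^q(\mathcal S)$ for every $1<q<\infty$. Weak solutions: a weak solution of $-Hu+au=f(\cdot,u)$ is a critical point of the $C^1$ functional $\Phi(u):=\frac12\|u\|_{\mathscr E}^2+\int_{\mathcal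 S}\big(\frac12(a-c)u^2-F(\cdot,u)\big)$ on $\mathscr E$, where $F(x,z)=\int_0^zf(x,r)\,dr$; i.e. $u\in\mathscr E$ with $\langle u,v\rangle_{\mathscr E}+\int_{\mathcal S}(a-c)uv=\int_{\mathcal S}f(\cdot,u)v$ for all $v\in\mathscr E$. Here $f(x,z)=z|z|^\ell$. *)

(* Defs.v *)
From HB Require Import structures.
From mathcomp Require Import all_boot all_order all_algebra.
From mathcomp Require Import all_classical all_reals all_analysis.

Set Implicit Arguments.
Unset Strict Implicit.
Unset Printing Implicit Defensive.

Import Order.TTheory GRing.Theory Num.Theory.
Import numFieldNormedType.Exports.

Local Open Scope classical_set_scope.
Local Open Scope ring_scope.

Section Plane.
Variable R : realType.
Implicit Types (V : set (R * R)) (F : R * R -> R).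

Definition unit_vec (i : 'I_2) : R * R := if i == ord0 then (1, 0) else (0, 1).

Definition coordinate (i : 'I_2) (z : R * R) : R := if i == ord0 then z.1 else z.2.

Definition partial (i : 'I_2) F : R * R -> R := fun z => 'D_(unit_vec i) F z.

(* For open V this is the usual C^n: existence and continuity on V of all
   iterated partial derivatives of order n (hence of those of lower order). *)
Fixpoint Cn (n : nat) V F : Prop :=
  match n with
  | 0%N => forall z, V z -> {for z, continuous F}
  | m.+1 => forall i, (forall z, V z -> derivable F z (unit_vec i))
                      /\ Cn m V (partial i F)
  end.

Definition smooth_on V F : Prop := forall n, Cn n V F.

Definition jacobian (T : R * R -> R * R) (z : R * R) : 'M[R]_2 :=
  \matrix_(i, j) partial j (coordinate i \o T) z.

End Plane.

Notation borel S := (g_sigma_algebraType (@open S)).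

Section Surface.
Variables (R : realType) (S : ptopologicalType).

(* coord is meaningful on dom only, and param on coord @` dom only. *)
Record chart := Chart {
  dom : set S;
  coord : S -> R * R;
  param : R * R -> S }.

Definition image_of (c : chart) : set (R * R) := coord c @` dom c.

Definition is_chart (c : chart) : Prop :=
  [/\ open (dom c),
      open (image_of c),
      forall x, dom c x -> param c (coord c x) = x,
      forall x, dom c x -> {for x, continuous (coord c)} &
      forall z, image_of c z -> {for z, continuous (param c)}].

Definition overlap (c c' : chart) : set (R * R) :=
  coord c @` (dom c `&` dom c').

Definition transition (c c' : chart) : R * R -> R * R := coord c' \o param c.

(* metric c z is the Gram matrix, at the point of coordinates z, of the
   coordinate frame of c. *)
Record closed_surface := ClosedSurface {
  atlas : set chart;
  chart_at : S -> chart;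
  metric : chart -> R * R -> 'M[R]_2;
  surface_compact : compact [set: S];
  surface_connected : connected [set: S];
  surface_hausdorff : hausdorff_space S;
  atlas_chart : forall c, atlas c -> is_chart c;
  atlas_cover : forall x, atlas (chart_at x) /\ dom (chart_at x) x;
  atlas_smooth : forall c c' i, atlas c -> atlas c' ->
    smooth_on (overlap c c') (coordinate i \o transition c c');
  metric_smooth : forall c i j, atlas c ->
    smooth_on (image_of c) (fun z => metric c z i j);
  metric_sym : forall c z, atlas c -> image_of c z ->
    (metric c z)^T = metric c z;
  metric_pos : forall c z (v : 'cV[R]_2), atlas c -> image_of c z -> v != 0 ->
    0 < (v^T *m metric c z *m v) ord0 ord0;
  metric_change : forall c c' z, atlas c -> atlas c' -> overlap c c' z ->
    let J := jacobian (transition c c') z in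
    metric c z = J^T *m metric c' (transition c c' z) *m J }.

Variable g : closed_surface.

Definition density (c : chart) (z : R * R) : R := Num.sqrt (\det (metric g c z)).

(* Determines mu uniquely, since countably many (in fact finitely many) charts
   cover S. *)
Definition is_volume (mu : {measure set (borel S) -> \bar R}) : Prop :=
  forall c (A : set (borel S)), atlas g c -> measurable A -> A `<=` dom c ->
  (mu A = \int[lebesgue_measure \x lebesgue_measure]_(z in coord c @` A)
            (density c z)%:E)%E.

Definition smooth (f : S -> R) : Prop :=
  forall c, atlas g c -> smooth_on (image_of c) (f \o param c).

(* Laplace-Beltrami operator (a nonpositive operator); on smooth functions the
   value does not depend on the chart around x. *)
Definition laplace (f : S -> R) : S -> R := fun x =>
  let c := chart_at g x in
  (density c (coord c x))^-1 *
  \sum_i partial i (fun z => \sum_j density c z * invmx (metric g c z) i j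
                                     * partial j (f \o param c) z) (coord c x).

End Surface.

Section FunctionSpaces.
Variables (R : realType) (S : ptopologicalType) (g : closed_surface R S).
Variable mu : {measure set (borel S) -> \bar R}.
Implicit Types u v : S -> R.

(* Elements of Lebesgue spaces are handled through representatives; equality in
   these spaces is equality mu-almost everywhere. *)
Definition Leb (q : \bar R) : set (S -> R) :=
  [set u | (u : borel S -> R) \in Lfun mu q].

Definition eq_mu u v : Prop := (u : borel S -> R) = v %[ae mu].

Definition Lqnorm (q : R) u : R := fine ('N[mu]_(q%:E)[EFin \o (u : borel S -> R)])%E.

Definition L2 : set (S -> R) := Leb 2%:E.

Definition L2norm u : R := Lqnorm 2 u.

Definition L2dot u v : R := Rintegral mu [set: borel S] (fun x => u x * v x).

Definition eigenbasis (e : nat -> S -> R) (lam : nat -> R) : Prop :=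
  [/\ forall n, smooth g (e n),
      forall n x, laplace g (e n) x = - lam n * e n x,
      forall m n, L2dot (e m) (e n) = (m == n)%:R &
      forall u, L2 u -> (forall n, L2dot u (e n) = 0) -> eq_mu u (cst 0)].

Variables (e : nat -> S -> R) (lam : nat -> R).

(* Fractional Sobolev space H^b = dom (1 - Delta)^(b/2) (b >= 0), with
   |u|_{H^b}^2 = sum_n (1 + lam n)^b <u, e n>^2. *)
Definition sobolev_terms (b : R) u : R^nat :=
  fun n => (1 + lam n) `^ b * L2dot u (e n) ^+ 2.

Definition sobolev (b : R) : set (S -> R) :=
  [set u | L2 u /\ cvgn (series (sobolev_terms b u))].

Definition sobolev_norm (b : R) u : R :=
  Num.sqrt (limn (series (sobolev_terms b u))).

Definition compactly_included (E F : set (S -> R)) (nE nF : (S -> R) -> R) : Prop :=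
  E `<=` F /\
  forall (phi : nat -> S -> R) (C : R),
    (forall n, E (phi n) /\ nE (phi n) <= C) ->
    exists (s : nat -> nat) (u : S -> R),
      [/\ {homo s : m n / (m < n)%N}, F u &
          (fun n => nF (phi (s n) - u)) @ \oo --> (0 : R)].

Definition dense_in (E F : set (S -> R)) (nF : (S -> R) -> R) : Prop :=
  E `<=` F /\
  forall u eps, F u -> 0 < eps -> exists2 u', E u' & nF (u' - u) < eps.

Section Noise.
Variables (d : measure_display) (Om : measurableType d) (P : probability Om R).

(* xi w f is the pairing of the distribution xi(w) with f; only its values on
   smooth f matter.  The norms |(1 - Delta)^k f|_{L^2} generate the topology of
   C^oo(S).  By linearity the one-dimensional laws make xi a Gaussian family;
   normal_prob is not the Dirac mass for zero variance, a case settled by the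
   covariance. *)
Record white_noise (xi : Om -> (S -> R) -> R) : Prop := {
  noise_linear : forall w k f1 f2, smooth g f1 -> smooth g f2 ->
    xi w (k *: f1 + f2) = k * xi w f1 + xi w f2;
  noise_continuous : forall w, exists (k : nat) (C : R), forall f, smooth g f ->
    `|xi w f| <= C * L2norm (iter k (fun h => h - laplace g h) f);
  noise_measurable : forall f, smooth g f ->
    measurable_fun [set: Om] (fun w => xi w f);
  noise_gaussian : forall f, smooth g f -> L2dot f f != 0 ->
    forall B : set R, measurable B ->
    P ((fun w => xi w f) @^-1` B) = normal_prob 0 (Num.sqrt (L2dot f f)) B;
  noise_covariance : forall f1 f2, smooth g f1 -> smooth g f2 ->
    ('E_P[fun w => (xi w f1 * xi w f2)%R] = (L2dot f1 f2)%:E)%E }.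

(* Heat regularisation exp(r Delta) xi. *)
Definition heat_noise (xi : Om -> (S -> R) -> R) (r : R) (w : Om) : S -> R :=
  fun x => limn (series (fun n => expR (- r * lam n) * xi w (e n) * e n x)).

(* H w is the graph of an operator on L^2(S).  The Anderson operator is the
   limit in the strong resolvent sense of the renormalised operators
   Delta + xi_r - kappa_r; for self-adjoint operators this is convergence of
   graphs, and smooth functions form a core of the regularised operators.
   kappa is deterministic, and a function rather than a constant so as to cover
   all the usual renormalisation conventions; convergence in probability
   as r tends to 0 is used along an almost surely convergent subsequence. *)
Definition anderson_operator (xi : Om -> (S -> R) -> R)
    (H : Om -> (S -> R) -> (S -> R) -> Prop) : Prop :=
  exists (r : R^nat) (kappa : nat -> S -> R),
    [/\ forall n, 0 < r n,
        r @ \oo --> (0 : R),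
        forall n, smooth g (kappa n) &
        {ae P, forall w, forall u v, H w u v <->
          [/\ L2 u, L2 v &
            exists phi : nat -> S -> R,
            [/\ forall n, smooth g (phi n),
                (fun n => L2norm (phi n - u)) @ \oo --> (0 : R) &
                (fun n => L2norm (laplace g (phi n)
                   + (heat_noise xi (r n) w - kappa n) * phi n - v))
                  @ \oo --> (0 : R)]]}].

End Noise.

Section Operator.
Variable H : (S -> R) -> (S -> R) -> Prop.

Definition op_dom : set (S -> R) := [set u | exists v, H u v].

Record closed_symmetric : Prop := {
  op_L2 : forall u v, H u v -> L2 u /\ L2 v;
  op_ae : forall u v u' v', L2 u' -> L2 v' -> eq_mu u u' -> eq_mu v v' ->
    H u v -> H u' v';
  op_functional : forall u v v', H u v -> H u v' -> eq_mu v v';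
  op_linear : forall k u v u' v', H u v -> H u' v' ->
    H (k *: u + u') (k *: v + v');
  op_dense : dense_in op_dom L2 L2norm;
  op_closed : forall (phi psi : nat -> S -> R) u v,
    (forall n, H (phi n) (psi n)) -> L2 u -> L2 v ->
    (fun n => L2norm (phi n - u)) @ \oo --> (0 : R) ->
    (fun n => L2norm (psi n - v)) @ \oo --> (0 : R) -> H u v;
  op_symmetric : forall u v u' v', H u v -> H u' v' -> L2dot v u' = L2dot u v' }.

(* H - z is a bijection from the domain of H onto L^2(S). *)
Definition shift_invertible (z : R) : Prop :=
  (forall f, L2 f -> exists u, H u (f + z *: u)) /\
  (forall u u' f, H u (f + z *: u) -> H u' (f + z *: u') -> eq_mu u u').

Definition compact_resolvent : Prop :=
  exists2 z : R, shift_invertible z &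
    forall (u f : nat -> S -> R) (C : R),
    (forall n, [/\ L2 (f n), H (u n) (f n + z *: u n) & L2norm (f n) <= C]) ->
    exists (s : nat -> nat) (u' : S -> R),
      [/\ {homo s : m n / (m < n)%N}, L2 u' &
          (fun n => L2norm (u (s n) - u')) @ \oo --> (0 : R)].

Definition invertible : Prop :=
  (forall f, L2 f -> exists u, H u f) /\
  (forall u u' f, H u f -> H u' f -> eq_mu u u').

Definition shifted_positive (c : R) : Prop :=
  forall u v, H u v -> ~ eq_mu u (cst 0) -> 0 < L2dot (c *: u - v) u.

Variables (E : set (S -> R)) (dot : (S -> R) -> (S -> R) -> R).

Definition norm_of (u : S -> R) : R := Num.sqrt (dot u u).

(* (E, dot) is a Hilbert space of L^2 functions that is the completion of the
   domain of H for the norm of the quadratic form of - H + c. *)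
Record energy_space (c : R) : Prop := {
  energy_L2 : E `<=` L2;
  energy_ae : forall u u', L2 u' -> eq_mu u u' -> E u -> E u';
  energy_linear : forall k u v, E u -> E v -> E (k *: u + v);
  energy_dotC : forall u v, E u -> E v -> dot u v = dot v u;
  energy_dotl : forall k u u' v, E u -> E u' -> E v ->
    dot (k *: u + u') v = k * dot u v + dot u' v;
  energy_ge0 : forall u, E u -> 0 <= dot u u;
  energy_eq0 : forall u, E u -> (dot u u = 0 <-> eq_mu u (cst 0));
  energy_complete : forall phi : nat -> S -> R, (forall n, E (phi n)) ->
    (forall eps, 0 < eps -> exists N, forall m n, (N <= m)%N -> (N <= n)%N ->
       norm_of (phi m - phi n) < eps) ->
    exists2 u, E u & (fun n => norm_of (phi n - u)) @ \oo --> (0 : R);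
  energy_form : forall u v u', H u v -> op_dom u' ->
    dot u u' = L2dot (c *: u - v) u';
  energy_dense : dense_in op_dom E norm_of }.

(* Weak solutions of - H u + a u = f(., u): the Euler-Lagrange equation of
   u |-> (dot u u)/2 + \int ((a - c) u^2 / 2 - F(., u)) on E, where F is the
   primitive of f in its second variable vanishing at 0. *)
Definition weak_solution (c : R) (a : S -> R) (f : S -> R -> R) (u : S -> R) : Prop :=
  E u /\
  forall v, E v ->
    dot u v + Rintegral mu [set: borel S] (fun x => (a x - c) * u x * v x)
    = Rintegral mu [set: borel S] (fun x => f x (u x) * v x).

End Operator.
End FunctionSpaces.

(* Main.v *)
(* Write N = l + 2, pot = a - c and J(u) = \int u^N.  The equation is
     B(u,v) - D(u,v) = \int u^(N-1) v,
   where B(u,v) = <u,v>_E + \int pot^+ u v makes E a Hilbert space and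
   D(u,v) = \int pot^- u v is nonnegative and compact.  No flow is needed: given
   u, let u' minimise the convex functional v |-> B(v,v) - 2 D(u,v) under the
   linear constraint \int u^(N-1) v = J(u).  The map u |-> u' is odd and
   continuous, decreases q = B - D, increases J by convexity, and is stationary
   only where B(u,.) - D(u,.) is a multiple of \int u^(N-1) (.); a multiple of
   such a u is a weak solution as soon as q(u) > 0.
   Suppose that no stationary point has scale-invariant energy q^(N/2)/J at
   least beta.  By compactness, finitely many iterations bring any finite
   dimensional sphere of E below the level beta.  The sublevel set of beta is
   compact in L^N up to scaling, so that finitely many linear forms do not vanish
   simultaneously on it.  Composing gives an odd map from a sphere of arbitrary
   dimension to a fixed R^k minus the origin, against Borsuk-Ulam.  Hence there
   are solutions of arbitrarily large L^N norm.
   Borsuk-Ulam for f = (f_1, ..., f_k) is proved with chains modulo 2 of tuples of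
   nearby points: coning the sphere S^d towards a new vertex in small steps gives
   hemispheres h_d with boundary h_(d-1) plus its antipode, on which the cup
   product of the coboundaries of the signs of the f_i evaluates to 1; so some
   small tuple sees every f_i change sign. *)
Require Import Defs.
From HB Require Import structures.
From mathcomp Require Import all_boot all_order all_algebra.
From mathcomp Require Import all_classical all_reals all_analysis.
From mathcomp Require Import measurable_realfun ess_sup_inf.
From mathcomp Require Import ring lra.
Import Order.TTheory GRing.Theory Num.Theory.
Import numFieldNormedType.Exports.
Local Open Scope classical_set_scope.
Local Open Scope ring_scope.

Set Implicit Arguments.
Unset Strict Implicit.
Unset Printing Implicit Defensive.

(** * Borsuk-Ulam *)

Section Chains.
Variable T : Type.
Implicit Types (phi : seq T -> bool) (s : seq T) (c z : seq (seq T)).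

(** Each entry is dropped in turn. The only face of a one-point tuple is the empty tuple, so the
    complex is augmented: a set of points is a cycle when its cardinality is even. *)
Fixpoint faces s : seq (seq T) :=
  if s is x :: s' then s' :: map (cons x) (faces s') else [::].

(* Chains are lists of tuples of points, considered modulo 2, and a bool-valued
   function of tuples is a cochain. *)
Definition pairing phi c : bool := \big[addb/false]_(s <- c) phi s.

(** The boundary occurs only through its transpose: an identity between chains is expressed by
    pairing with all cochains, which spares any normal form of chains modulo 2. *)
Definition cobd phi s : bool := pairing phi (faces s).

(** The usual triangulation of the prism between [map F s] and [map G s], made of the tuples F x0,
    ..., F xi, G xi, ..., G xn. *)
Fixpoint prism (F G : T -> T) s : seq (seq T) :=
  if s is x :: s' then
    (F x :: G x :: map G s') :: map (cons (F x)) (prism F G s')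
  else [::].

Lemma pairing_cons phi s c : pairing phi (s :: c) = phi s (+) pairing phi c.
Proof. by rewrite /pairing big_cons. Qed.

Lemma pairing_cat phi c c' :
  pairing phi (c ++ c') = pairing phi c (+) pairing phi c'.
Proof. by rewrite /pairing big_cat. Qed.

Lemma pairing_map phi f c : pairing phi (map f c) = pairing (phi \o f) c.
Proof. by rewrite /pairing big_map. Qed.

Lemma pairing_flatten phi (f : seq T -> seq (seq T)) c :
  pairing phi (flatten (map f c)) = pairing (fun s => pairing phi (f s)) c.
Proof.
by elim: c => [|s c IH] /=; rewrite ?pairing_cons ?pairing_cat ?IH// /pairing !big_nil.
Qed.

Lemma pairingD phi psi c :
  pairing (fun s => phi s (+) psi s) c = pairing phi c (+) pairing psi c.
Proof. by rewrite /pairing big_split. Qed.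

Lemma cobd_cons phi x s : cobd phi (x :: s) = phi s (+) cobd (phi \o cons x) s.
Proof. by rewrite /cobd /= pairing_cons pairing_map. Qed.

Lemma eq_pairing phi psi c : phi =1 psi -> pairing phi c = pairing psi c.
Proof. by move=> e; apply: eq_bigr => s _. Qed.

Lemma cobd_cobd phi s : cobd (cobd phi) s = false.
Proof.
elim: s phi => [|x s IH] phi; first by rewrite /cobd /pairing big_nil.
rewrite cobd_cons [X in _ (+) X](_ : _ =
  cobd (fun s' => phi s' (+) cobd (phi \o cons x) s') s); last first.
  by apply: eq_pairing => s' /=; rewrite cobd_cons.
by rewrite {2}/cobd pairingD -/(cobd _ _) -/(cobd (cobd _) s) IH addbF addbb.
Qed.

(** The chain homotopy formula: the boundary of the prism is its two ends plus the prism over the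
    boundary. The induction removes the first vertex and needs [phi] arbitrary, since [phi] becomes
    [phi \o cons (F x)]. *)
Lemma cobd_prism phi F G s :
  pairing (cobd phi) (prism F G s) =
  phi (map G s) (+) phi (map F s) (+) cobd (fun s' => pairing phi (prism F G s')) s.
Proof.
elim: s phi => [|x s IH] phi.
  by rewrite /cobd /pairing !big_nil addbF addbb.
rewrite /= pairing_cons !cobd_cons pairing_map.
rewrite [X in _ (+) X](_ : _ = pairing phi (prism F G s) (+)
   pairing (cobd (phi \o cons (F x))) (prism F G s)); last first.
  by rewrite -pairingD; apply: eq_pairing => s' /=; rewrite cobd_cons.
rewrite IH [cobd ((fun _ => _) \o _) s](_ : _ =
  cobd (phi \o cons (F x) \o cons (G x) \o map G) s (+)
  cobd (fun s' => pairing (phi \o cons (F x)) (prism F G s')) s); last first.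
  by rewrite -pairingD; apply: eq_pairing => s' /=; rewrite pairing_cons pairing_map.
have -> : cobd (phi \o cons (F x) \o cons (G x)) (map G s) =
   cobd (phi \o cons (F x) \o cons (G x) \o map G) s.
  move: (phi \o cons (F x) \o cons (G x)) => psi.
  elim: s psi {IH} => [|y s IH] psi; first by rewrite /cobd /pairing !big_nil.
  by rewrite /= !cobd_cons IH.
rewrite /=.
have AC (a b c p e f : bool) : a (+) (b (+) c) (+) (p (+) (b (+) f (+) e)) =
    a (+) f (+) (p (+) (c (+) e)) by case: a b c p e f => [] [] [] [] [] [].
exact: AC.
Qed.

Definition is_cycle z := forall phi, pairing (cobd phi) z = false.

(* The trace of z along the steps of the discrete homotopy H. *)
Definition fill (H : nat -> T -> T) M z :=
  flatten [seq flatten [seq prism (H t) (H t.+1) s | s <- z] | t <- iota 0 M].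

(** The lateral terms vanish because [z] is a cycle, and the intermediate ends cancel in pairs. *)
Lemma cobd_fill_ends phi H M z : is_cycle z ->
  pairing (cobd phi) (fill H M z) =
  pairing (fun s => phi (map (H M) s)) z (+) pairing (fun s => phi (map (H 0%N) s)) z.
Proof.
move=> cz; elim: M => [|M IH]; first by rewrite addbb /fill /pairing big_nil.
rewrite /fill -addn1 iotaD map_cat flatten_cat pairing_cat -/(fill H M z) IH /=.
rewrite cats0 add0n addn1 pairing_flatten.
rewrite [X in _ (+) X](eq_pairing _ (cobd_prism phi _ _)) !pairingD.
by rewrite cz addbF addbC addbA -[in RHS](addbK (pairing (fun s => phi (map (H M) s)) z)
  (pairing _ z)) -!addbA; congr (_ (+) _); rewrite addbCA addbC !addbA addbC.
Qed.

End Chains.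

(** * Cup products of sign changes, evaluated on hemispheres *)

Section Cup.
Variables (T : eqType) (sg : nat -> T -> bool).
Implicit Types (s : seq T) (z : seq (seq T)).

(* Cup product of the coboundaries of the 0-cochains sg (d - 1), ..., sg 0. *)
Fixpoint cup d s : bool :=
  match d, s with
  | d'.+1, x :: (y :: _) as s' => (sg d' x (+) sg d' y) && cup d' s'
  | _.+1, _ => false
  | 0%N, _ => true
  end.

(** The cup product of [sg d] itself, not of its coboundary, with [cup d]: a primitive of
    [cup d.+1]. *)
Definition sgcup d s : bool := if s is x :: _ then sg d x && cup d s else false.

Lemma size_faces s s' : s' \in faces s -> size s = (size s').+1.
Proof.
elim: s s' => //= x s IH s'; rewrite inE => /orP[/eqP->//|/mapP[r /IH + ->]] /=.
by move=> ->.
Qed.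

Lemma eq_in_pairing (phi psi : seq T -> bool) z : {in z, phi =1 psi} ->
  pairing phi z = pairing psi z.
Proof. by move=> e; apply: eq_big_seq. Qed.

(** Leibniz rule, given that [cup d] is a cocycle. The two facts are proved together: [cup d.+1],
    being a coboundary, is again a cocycle. The size matters because [cup d] ignores all but the
    first d + 1 entries. *)
Lemma cupE d s : size s = d.+2 -> cup d.+1 s = cobd (sgcup d) s.
Proof.
suff H : forall d, (forall s, size s = d.+2 -> cobd (cup d) s = false) /\
  (forall s, size s = d.+2 -> cup d.+1 s = cobd (sgcup d) s) by exact: (H d).2.
move=> {d s}.
have step d' : (forall s, size s = d'.+2 -> cobd (cup d') s = false) ->
  (forall s, size s = d'.+2 -> cup d'.+1 s = cobd (sgcup d') s).
  move=> cocycle [|x [|y s']]// sz; have := cocycle _ sz.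
  rewrite cobd_cons => /(congr1 (addb (cup d' (y :: s')))); rewrite addbA addbb addFb addbF.
  move=> coc; rewrite cobd_cons.
  rewrite [X in _ = _ (+) X](_ : _ = sg d' x && cobd (cup d' \o cons x) (y :: s')).
    rewrite coc -[sgcup _ _]/(sg d' y && cup d' (y :: s')) -andb_addl addbC.
    by [].
  have E : sgcup d' \o cons x =1 (fun r => sg d' x && cup d' (x :: r)) by [].
  rewrite /cobd (eq_pairing _ E) /pairing; case: (sg d' x) => //=; rewrite ?andFb ?big1//.
elim=> [|d' [_ IH]].
  have c0 s : size s = 2 -> cobd (cup 0) s = false.
    by case: s => [|x [|y []]]// _; rewrite /cobd /pairing /= !big_cons big_nil.
  by split=> //; exact: step.
have cS s : size s = d'.+3 -> cobd (cup d'.+1) s = false.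
  move=> sz; rewrite -(cobd_cobd (sgcup d') s); apply: eq_in_pairing => r rs.
  by rewrite IH//; have := size_faces rs; rewrite sz => -[].
by split=> //; exact: step.
Qed.

Variables (neg : T -> T) (negK : involutive neg).
Variables (H : nat -> nat -> T -> T) (M : nat) (e : nat -> T).
Hypothesis H0 : forall d x, H d 0%N x = x.
Hypothesis HM : forall d x, H d M x = e d.

Definition double z := z ++ map (map neg) z.

(* Modulo 2, the boundary of hemi d.+1 is hemi d plus its antipode: hemi d is a
   hemisphere of dimension d, obtained by coning off the sphere below it. *)
Fixpoint hemi d : seq (seq T) :=
  if d is d'.+1 then fill (H d) M (double (hemi d')) else [:: [:: e 0%N]].

Lemma mem_prism (F G : T -> T) s r : r \in prism F G s ->
  size r = (size s).+1 /\ {subset r <= map F s ++ map G s}.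
Proof.
elim: s r => //= x s IH r; rewrite inE => /orP[/eqP->|/mapP[q /IH[sq subq] ->]] /=.
  rewrite size_map; split=> // y; rewrite !inE mem_cat inE.
  by case/or3P => -> ; rewrite ?orbT.
split; first by rewrite sq.
move=> y; rewrite inE => /orP[/eqP->|/subq]; first by rewrite inE eqxx.
by rewrite inE !mem_cat inE => /orP[]->; rewrite ?orbT.
Qed.

Lemma mem_hemiS d r : r \in hemi d.+1 -> exists t s, [/\ (t < M)%N,
  s \in double (hemi d), size r = (size s).+1 &
  {subset r <= map (H d.+1 t) s ++ map (H d.+1 t.+1) s}].
Proof.
move=> /flattenP[c /mapP[t]]; rewrite mem_iota /= add0n => tM -> /flattenP[c' /mapP[s sz ->]].
by move=> /mem_prism[? ?]; exists t, s.
Qed.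

Lemma size_hemi d s : s \in hemi d -> size s = d.+1.
Proof.
elim: d s => [|d IH] s; first by rewrite inE => /eqP->.
move=> /mem_hemiS[t [r [_ + -> _]]]; rewrite mem_cat => /orP[/IH->//|/mapP[q /IH + ->]].
by rewrite size_map => ->.
Qed.

Lemma size_double d s : s \in double (hemi d) -> size s = d.+1.
Proof.
rewrite mem_cat => /orP[/size_hemi//|/mapP[q /size_hemi + ->]].
by rewrite size_map.
Qed.

Lemma pairing_double phi z :
  pairing phi (double z) = pairing (fun s => phi s (+) phi (map neg s)) z.
Proof. by rewrite /double pairing_cat pairing_map pairingD. Qed.

Lemma pairing_const (b : bool) z : pairing (fun=> b) z = b && odd (size z).
Proof.
elim: z => [|s z IH]; first by rewrite /pairing big_nil andbF.
by rewrite pairing_cons IH /=; case: {IH} b.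
Qed.

Lemma cobd_negate phi s : cobd phi (map neg s) = cobd (phi \o map neg) s.
Proof.
elim: s phi => [|x s IH] phi; first by rewrite /cobd /pairing !big_nil.
by rewrite /= !cobd_cons IH.
Qed.

(** By joint induction. If the doubled hemisphere is a cycle, coning it off leaves that cycle as the
    boundary; the boundary of the next hemisphere is then invariant under the antipode, so that it
    cancels in the next double. *)
Lemma double_cycle d : is_cycle (double (hemi d)) /\
  forall phi, pairing (cobd phi) (hemi d.+1) = pairing phi (double (hemi d)).
Proof.
have step d' : is_cycle (double (hemi d')) ->
    forall phi, pairing (cobd phi) (hemi d'.+1) = pairing phi (double (hemi d')).
  move=> cz phi; rewrite [hemi _]/= cobd_fill_ends//.
  rewrite (@eq_in_pairing _ (fun=> phi (nseq d'.+1 (e d'.+1)))); last first.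
    move=> s /size_double sz; congr phi.
    by rewrite -{2}sz; elim: s {sz} => //= x s ->; rewrite HM.
  (* At the far end of the cone all tuples have become the same constant tuple, and there is an even
     number of them. *)
  rewrite pairing_const size_cat size_map addnn odd_double andbF addFb.
  by apply: eq_pairing => s; congr phi; rewrite (eq_map (H0 _)) map_id.
elim: d => [|d [_ IH]].
  have c0 : is_cycle (double (hemi 0)).
    move=> phi; rewrite /double /= /pairing !big_cons big_nil /cobd /pairing /=.
    by rewrite !big_cons !big_nil !addbF addbb.
  by split=> //; exact: step.
have cS : is_cycle (double (hemi d.+1)).
  move=> phi; rewrite pairing_double pairingD.
  rewrite [X in _ (+) X](eq_pairing _ (cobd_negate phi)) !IH !pairing_double -pairingD.
  rewrite /pairing big1// => s _ /=; rewrite mapK//.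
  by case: (phi s); case: (phi _).
by split=> //; exact: step.
Qed.

(** Descent on the dimension: [cup d.+1] is the coboundary of [sgcup d], hence its value on
    [hemi d.+1] is that of [sgcup d] on [hemi d] plus its antipode. The antipode preserves [cup d],
    which sees only changes of sign, and flips [sg d]; what remains is [cup d] on [hemi d]. *)
Lemma cup_hemi k : (forall d s x, (d < k)%N -> s \in hemi d -> x \in s ->
    forall i, (i < k)%N -> sg i (neg x) = ~~ sg i x) ->
  pairing (cup k) (hemi k) = true.
Proof.
move=> sgN.
suff : forall d, (d <= k)%N -> pairing (cup d) (hemi d) = true by move=> /(_ _ (leqnn _)).
elim=> [_|d IH dk]; first by rewrite /pairing /= big_cons big_nil.
apply: etrans (IH (ltnW dk)).
rewrite (@eq_in_pairing _ (cobd (sgcup d))); last first.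
  by move=> s /size_hemi; exact: cupE.
rewrite (double_cycle d).2 pairing_double; apply: eq_in_pairing => s sd.
have cupN : forall d' s', (d' <= k)%N ->
    (forall x, x \in s' -> forall i, (i < k)%N -> sg i (neg x) = ~~ sg i x) ->
    cup d' (map neg s') = cup d' s'.
  elim=> // d' IHd [|x [|y s']]// d'k sN.
  rewrite [LHS]/= [RHS]/= -/(map neg (y :: s')) (IHd (y :: s') (ltnW d'k)); last first.
    by move=> z zs; apply: sN; rewrite inE zs orbT.
  congr (_ && _); rewrite !sN ?inE ?eqxx ?orbT//.
  by case: (sg _ x); case: (sg _ y).
have cN := cupN d s (ltnW dk) (fun x => sgN d s x dk sd).
case: s sd cN => [/size_hemi//|x s] sd cN.
have sgx : sg d (neg x) = ~~ sg d x by apply: (sgN _ _ _ dk sd); rewrite ?inE ?eqxx.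
rewrite -[sgcup d (map neg _)]/(sg d (neg x) && cup d (map neg (x :: s))) cN.
rewrite -[sgcup d (x :: s)]/(sg d x && cup d (x :: s)) sgx.
by case: (sg d x); rewrite ?addbF ?addFb//=; case: (cup _ _).
Qed.

End Cup.

Lemma cup_signs (T : eqType) (sg : nat -> T -> bool) d s i : cup sg d s -> (i < d)%N ->
  exists x y, [/\ x \in s, y \in s & sg i x != sg i y].
Proof.
elim: d s => // d IH [|x [|y s]]// /andP[sxy cs]; rewrite ltnS leq_eqVlt => /orP[/eqP->|id].
  by exists x, y; rewrite !inE !eqxx orbT -negb_add sxy; split.
have [a [b [sa sb ab]]] := IH _ cs id; exists a, b.
by rewrite [a \in _]in_cons [b \in _]in_cons sa sb !orbT; split.
Qed.

(** [tau] marks the canonical representative of each pair of antipodes. It provides antipodal signs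
    at the zeros of an odd function. *)
Lemma antipodal_choice (V : choiceType) (neg : V -> V) :
  involutive neg ->
  exists tau : V -> bool, forall x, neg x != x -> tau (neg x) = ~~ tau x.
Proof.
move=> negK; pose P x := pred2 x (neg x).
exists (fun x => choose (P x) x == x) => x xN.
have Px : P x x by rewrite /= eqxx.
have PNx : P x (neg x) by rewrite /= eqxx orbT.
have -> : choose (P (neg x)) (neg x) = choose (P x) x.
  have e : P (neg x) =1 P x by move=> y; rewrite /P /= negK orbC.
  by rewrite (eq_choose e); apply: choose_id.
have /= := chooseP Px => /orP[/eqP->|/eqP->]; rewrite eqxx ?xN//.
by rewrite eq_sym (negbTE xN).
Qed.

(** * The octahedral sphere and odd continuous functions on it *)

Section Octahedron.
Variables (R : realType) (k : nat).
Local Notation P := 'rV[R]_k.+1.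

(** With this norm, the segment from a unit vector to a coordinate vertex outside its support stays
    in the unit sphere, so that cones need no normalisation. *)
Definition l1 (x : P) : R := \sum_j `|x ord0 j|.

Lemma l1D x y : l1 (x + y) <= l1 x + l1 y.
Proof. by rewrite /l1 -big_split ler_sum// => j _; rewrite mxE ler_normD. Qed.

Lemma l1Z t x : l1 (t *: x) = `|t| * l1 x.
Proof. by rewrite /l1 mulr_sumr; apply: eq_bigr => j _; rewrite mxE normrM. Qed.

Lemma l1N x : l1 (- x) = l1 x.
Proof. by apply: eq_bigr => j _; rewrite mxE normrN. Qed.

Lemma l1_ge_coord (x : P) j : `|x ord0 j| <= l1 x.
Proof. by rewrite /l1 (bigD1 j)//= lerDl sumr_ge0. Qed.

Lemma norm_le_l1 (x : P) : `|x| <= l1 x.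
Proof.
rewrite -[leLHS]/(mx_norm x) mx_normrE; apply: bigmax_le => [|[i j] _ /=].
  by rewrite sumr_ge0.
by rewrite (ord1 i) l1_ge_coord.
Qed.

Definition vertex d : P := delta_mx ord0 (inord d).

Lemma l1_vertex d : l1 (vertex d) = 1.
Proof.
rewrite /l1 (bigD1 (inord d))//= mxE !eqxx normr1 big1 ?addr0// => j jd.
by rewrite mxE (negbTE jd) andbF normr0.
Qed.

Definition cone M d t (x : P) : P := (1 - t%:R / M%:R) *: x + (t%:R / M%:R) *: vertex d.

Definition on_sphere d (x : P) := l1 x = 1 /\ forall j : 'I_k.+1, (d < j)%N -> x ord0 j = 0.

Lemma ratio01 (t M : nat) : (t <= M)%N -> 0 <= (t%:R / M%:R : R) <= 1.
Proof.
move=> tM; rewrite divr_ge0 ?ler0n//=; case: M tM => [|M] tM; first by rewrite invr0 mulr0 ler01.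
by rewrite ler_pdivrMr ?ltr0n// mul1r ler_nat.
Qed.

Lemma on_sphere_cone M d t x : (d < k)%N -> (t <= M)%N -> on_sphere d x ->
  on_sphere d.+1 (cone M d.+1 t x).
Proof.
move=> dk tM [x1 xd]; have /andP[r0 r1]     := ratio01 tM.
have idE : (inord d.+1 : 'I_k.+1) = d.+1 :> nat by rewrite inordK// ltnS.
split=> [|j dj]; last first.
  rewrite !mxE xd ?(ltn_trans _ dj)// mulr0 add0r.
  case: (j =P _) => [ji|]; last by rewrite andbF mulr0.
  by move: dj; rewrite ji idE ltnn.
rewrite /l1 (eq_bigr (fun j => `|((1 - t%:R / M%:R) *: x) ord0 j| +
   `|((t%:R / M%:R) *: vertex d.+1) ord0 j|)); last first.
  move=> j _; rewrite !mxE eqxx /=; case: (j =P _) => [ji|]; last by rewrite mulr0 normr0 !addr0.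
  by rewrite xd ?ji ?idE// mulr0 normr0 !add0r.
rewrite big_split -!/(l1 _) /= !l1Z x1 l1_vertex !mulr1 !ger0_norm ?subr_ge0//.
by rewrite subrK.
Qed.

(** Times at most one step apart move a point by at most 2 / M, and coning at equal times contracts.
    The diameter of the tuples thus grows by 2 / M with each dimension. *)
Lemma l1_cone M d t t' x y (e : R) : (t <= M)%N -> (t' <= t.+1)%N -> (t <= t'.+1)%N ->
  l1 x = 1 -> l1 y = 1 -> l1 (x - y) <= e ->
  l1 (cone M d t x - cone M d t' y) <= e + 2 / M%:R.
Proof.
move=> tM tt' t't x1 y1 xye; have /andP[r0 r1]     := ratio01 tM.
have -> : cone M d t x - cone M d t' y = (1 - t%:R / M%:R) *: (x - y) +
    ((t%:R - t'%:R) / M%:R) *: (vertex d - y).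
  by apply/rowP => j; rewrite !mxE; ring.
apply: le_trans (l1D _ _) _; apply: lerD.
  rewrite l1Z ger0_norm ?subr_ge0//; apply: le_trans xye; rewrite ler_piMl//.
    by rewrite sumr_ge0.
have d1 : `|t%:R - t'%:R| <= 1 :> R.
  move: tt' t't; rewrite -!(ler_nat R) -!natr1 => tt' t't.
  by rewrite ler_norml; apply/andP; split; lra.
have l2 : l1 (vertex d - y) <= 2.
  by apply: le_trans (l1D _ _) _; rewrite l1N l1_vertex y1.
rewrite l1Z normrM mulrAC [`|M%:R^-1|]ger0_norm ?invr_ge0//.
rewrite ler_wpM2r ?invr_ge0// -[leRHS]mul1r ler_pM ?normr_ge0//.
by rewrite sumr_ge0.
Qed.

Local Notation hemi M := (hemi (@GRing.opp P) (cone M) M vertex).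

Lemma hemi_sphere M d s : (d <= k)%N -> s \in hemi M d ->
  (forall x, x \in s -> on_sphere d x) /\
  (forall x y, x \in s -> y \in s -> l1 (x - y) <= d%:R * (2 / M%:R)).
Proof.
elim: d s => [|d IH] s dk.
  rewrite inE => /eqP->; split=> x.
    rewrite inE => /eqP->; split=> [|j j0]; first exact: l1_vertex.
    rewrite mxE; case: (j =P _) => [ji|]; last by rewrite andbF.
    by move: j0; rewrite ji inordK.
  move=> y; rewrite !inE => /eqP-> /eqP->; rewrite subrr mul0r /l1 big1// => j _.
  by rewrite mxE normr0.
have sphN x : on_sphere d x -> on_sphere d (- x).
  by case=> x1 xd; split; [rewrite l1N|move=> j /xd; rewrite mxE => ->; rewrite oppr0].
move=> /mem_hemiS[t [r [tM rd _ sub]]].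
have {IH}[rS rD] : (forall x, x \in r -> on_sphere d x) /\
    (forall x y, x \in r -> y \in r -> l1 (x - y) <= d%:R * (2 / M%:R)).
  move: rd; rewrite mem_cat => /orP[rd|/mapP[q /(IH _ (ltnW dk))[qS qD] ->]].
    exact: IH (ltnW dk) rd.
  split=> [x /mapP[x' /qS x'S ->]|x y /mapP[x' x'q ->] /mapP[y' y'q ->]]; first exact: sphN.
  by rewrite -opprD l1N; apply: qD.
have {}sub x : x \in s -> exists t' x', [/\ x' \in r, (t <= t' <= t.+1)%N & x = cone M d.+1 t' x'].
  move=> /sub; rewrite mem_cat => /orP[] /mapP[x' x'r ->]; [exists t|exists t.+1]; exists x'.
    by rewrite leqnn leqnSn.
  by rewrite leqnn leqnSn.
split=> [x /sub[t' [x' [x'r /andP[tt' t't] ->]]]|x y].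
  by apply: on_sphere_cone (rS _ x'r) => //; apply: leq_trans t't _.
move=> /sub[t' [x' [x'r /andP[tt' t't] ->]]] /sub[t'' [y' [y'r /andP[tt'' t''t] ->]]].
rewrite -natr1 mulrDl mul1r; apply: l1_cone.
- exact: leq_trans t't _.
- by rewrite (leq_trans t''t).
- by rewrite (leq_trans t't).
- by have [] := rS _ x'r.
- by have [] := rS _ y'r.
- exact: rD.
Qed.

(** A form of Tucker's lemma: since the cup product is 1 on the hemisphere, it is nonzero on one of
    its tuples, and then so is each factor. *)
Lemma tucker M (sg : nat -> P -> bool) : (0 < M)%N ->
  (forall i x, (i < k)%N -> l1 x = 1 -> sg i (- x) = ~~ sg i x) ->
  exists s : seq P, [/\ s != [::], forall x, x \in s -> l1 x = 1,
    forall x y, x \in s -> y \in s -> l1 (x - y) <= k%:R * (2 / M%:R) &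
    forall i, (i < k)%N -> exists x y, [/\ x \in s, y \in s & sg i x != sg i y]].
Proof.
move=> M0 sgN.
have cE : pairing (cup sg k) (hemi M k) = true.
  apply: cup_hemi.
  - exact: opprK.
  - by move=> d x; rewrite /cone mul0r subr0 scale1r scale0r addr0.
  - by move=> d x; rewrite /cone divff ?pnatr_eq0 -?lt0n// subrr scale0r add0r scale1r.
  - move=> d s x dk /(hemi_sphere (ltnW dk))[sS _] /sS[x1 _] i ik; exact: sgN.
have [s sk cs] : exists2 s, s \in hemi M k & cup sg k s.
  apply: contrapT => no; move: cE; rewrite /pairing big_seq big1//.
  by move=> s sk; apply/negP => cs; apply: no; exists s.
have [sS sD] := hemi_sphere (leqnn k) sk.
exists s; split=> //.
- by case: (s) (size_hemi sk).
- by move=> x /sS[].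
- by move=> i; apply: cup_signs.
Qed.

Lemma l1_continuous : continuous l1.
Proof.
apply: continuous_big => [|j _ x]; first exact: add_continuous.
apply: (@continuous_comp P R R (fun x : P => x ord0 j) Num.norm); last exact: norm_continuous.
exact: (@coord_continuous R _ _ ord0 j).
Qed.

Lemma sphere_compact : compact [set x : P | l1 x = 1].
Proof.
apply: bounded_closed_compact.
  exists 1; split=> // M M1 x /= x1; apply: le_trans (ltW M1).
  by rewrite -x1 norm_le_l1.
rewrite (_ : [set _ | _] = l1 @^-1` [set 1])//.
by apply: closed_comp => [x _|]; [exact: l1_continuous|exact: closed_eq].
Qed.

(** The tuples of [tucker] for finer and finer steps accumulate at some [x]. Were [f i x] nonzero,
    the sign of [f i] would be constant near [x], hence on one of these tuples. *)
Theorem borsuk_ulam (f : nat -> P -> R) :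
  (forall i x, (i < k)%N -> l1 x = 1 -> f i (- x) = - f i x) ->
  (forall i x, (i < k)%N -> l1 x = 1 -> {for x, continuous (f i)}) ->
  exists2 x, l1 x = 1 & forall i, (i < k)%N -> f i x = 0.
Proof.
move=> fN fc.
have [tau tauN] := @antipodal_choice P -%R (@opprK P).
(* The sign must be antipodal everywhere, also where [f i] vanishes. *)
pose sg i x := if f i x == 0 then tau x else 0 < f i x.
have sgN i x : (i < k)%N -> l1 x = 1 -> sg i (- x) = ~~ sg i x.
  move=> ik x1; rewrite /sg fN// oppr_eq0 oppr_gt0; case: eqP => [_|/eqP fx].
    apply: tauN; apply/eqP => xx; have : l1 x = 0.
      rewrite /l1 big1// => j _; have := congr1 (fun x : P => x ord0 j) xx; rewrite mxE => xj.
      have -> : x ord0 j = 0 by lra.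
      by rewrite normr0.
    by rewrite x1; apply/eqP; rewrite oner_eq0.
  by rewrite -leNgt le_eqVlt (negbTE fx).
have /(choice) : forall M, exists s : seq P, [/\ s != [::], forall x, x \in s -> l1 x = 1,
    forall x y, x \in s -> y \in s -> l1 (x - y) <= k%:R * (2 / M.+1%:R) &
    forall i, (i < k)%N -> exists x y, [/\ x \in s, y \in s & sg i x != sg i y]].
  by move=> M; apply: tucker.
move=> [s sP].
pose p M := head 0 (s M).
have ps M : p M \in s M.
  by rewrite /p; have [+ _ _ _] := sP M; case: (s M) => //= a l _; rewrite inE eqxx.
have p1 M : l1 (p M) = 1 by have [_ + _ _] := sP M; apply; exact: ps.
have [x [x1 xc]] : [set x : P | l1 x = 1] `&` cluster (p @ \oo) !=set0.
  apply: sphere_compact.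
  exact: (@filterE nat \oo _ (fun M => l1 (p M) = 1) p1).
exists x => // i ik; apply: contrapT => /eqP fx.
move: (fc i x ik x1) => /cvgrPdist_lt/(_ `|f i x|); rewrite normr_gt0 => /(_ fx).
move=> /nbhs_ballP[d /= d0 dP].
have near_sg y : l1 (x - y) < d -> sg i y = (0 < f i x).
  move=> xy; have := dP y; rewrite -ball_normE /= => /(_ _) H.
  have {}H : `|f i x - f i y| < `|f i x|.
    by apply: H; apply: le_lt_trans xy; exact: norm_le_l1.
  have fy : f i y != 0 by apply/eqP => fy; move: H; rewrite fy subr0 ltxx.
  rewrite /sg (negbTE fy).
  move: H; case: (ltrgtP 0 (f i x)) fx => // fx0 _.
    by rewrite (gtr0_norm fx0) ltr_norml => /andP[_ h]; apply/idP; lra.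
  rewrite (ltr0_norm fx0) ltr_norml => /andP[h _]; apply/negP/negP; rewrite -leNgt; lra.
have [M [pM Md]] : exists M, l1 (x - p M) < d / 2 /\ k%:R * (2 / M.+1%:R) < d / 2.
  have A : (p @ \oo) [set y | exists M, y = p M /\ k%:R * (2 / M.+1%:R) < d / 2].
    have : \forall M \near \oo, k%:R * (2 / M.+1%:R) < d / 2 :> R.
      have : (fun M => k%:R * (2 / M.+1%:R)) @ \oo --> (0 : R).
        rewrite -(mulr0 (k%:R : R)) -(mulr0 (2 : R)); apply: cvgMl_tmp; apply: cvgMl_tmp.
        exact: cvg_harmonic.
      by move=> /cvgrPdist_lt/(_ (d / 2)); rewrite divr_gt0// => /(_ isT); apply: filterS => M;
        rewrite sub0r normrN ger0_norm// mulr_ge0// divr_ge0.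
    by apply: filterS => M Md; exists M.
  have Bn : nbhs x [set y | l1 (x - y) < d / 2].
    have : {for x, continuous (fun y : P => l1 (x - y))}.
      apply: (@continuous_comp P P R (fun y : P => (x - y : P)) l1); last exact: l1_continuous.
      by apply: (@cvgB R P P (nbhs x) _ (cst x) id x x); [exact: cvg_cst|exact: cvg_id].
    move=> /cvgrPdist_lt/(_ (d / 2)); rewrite divr_gt0// => /(_ isT).
    rewrite subrr (_ : l1 0 = 0); last by rewrite /l1 big1// => j _; rewrite mxE normr0.
    by apply: filterS => y; rewrite sub0r normrN; apply: le_lt_trans (ler_norm _).
  by have [y [[M [-> ?]] ?]] := xc _ _ A Bn; exists M.
have [_ s1 sD sC] := sP M.
have near_s y : y \in s M -> sg i y = (0 < f i x).
  move=> ys; apply: near_sg; rewrite -(subrK (p M) x) -addrA; apply: le_lt_trans (l1D _ _) _.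
  by rewrite [ltRHS]splitr ltrD// (le_lt_trans (sD _ _ (ps M) ys)).
have [a [b [sa sb]]] := sC _ ik.
by rewrite !near_s ?eqxx.
Qed.

End Octahedron.

Lemma cvg_dist_le (R : realType) (T : Type) (F : set_system T) {FF : Filter F}
    (f h : T -> R) (a : R) :
  h t @[t --> F] --> 0 -> (\forall t \near F, `|f t - a| <= h t) -> f t @[t --> F] --> a.
Proof.
move=> h0 fh; apply/cvgrPdist_lt => eps eps0.
move/cvgrPdist_lt: h0 => /(_ _ eps0); apply: filterS2 fh => t fh.
rewrite sub0r normrN distrC => ht; apply: le_lt_trans fh _.
by apply: le_lt_trans ht; exact: ler_norm.
Qed.

(** * Semi-inner products *)

Section SemiInnerProduct.
Variables (R : realType) (V : lmodType R).
Implicit Types (B : V -> V -> R) (u v w : V).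

Record semi_inner B : Prop := SemiInner {
  sipC : forall u v, B u v = B v u;
  sipl : forall t u u' v, B (t *: u + u') v = t * B u v + B u' v;
  sip_ge0 : forall u, 0 <= B u u }.

Definition snorm B u : R := Num.sqrt (B u u).

Definition vcvg B {T : Type} (F : set_system T) (g : T -> V) (l : V) :=
  snorm B (g t - l) @[t --> F] --> (0 : R).

Definition vcauchy (n : V -> R) (g : nat -> V) :=
  forall eps, 0 < eps -> exists N, forall i j, (N <= i)%N -> (N <= j)%N -> n (g i - g j) < eps.

Definition complete B :=
  forall g, vcauchy (snorm B) g -> exists l, vcvg B \oo g l.

Section Theory.
Variables (B : V -> V -> R) (sB : semi_inner B).
Local Notation nb := (snorm B).

Lemma sipDl u u' v : B (u + u') v = B u v + B u' v.
Proof. by rewrite -[u in LHS]scale1r (sipl sB) mul1r. Qed.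

Lemma sip0l v : B 0 v = 0.
Proof. by have := sipDl 0 0 v; rewrite addr0; lra. Qed.

Lemma sipZl t u v : B (t *: u) v = t * B u v.
Proof. by rewrite -[t *: u]addr0 (sipl sB) sip0l addr0. Qed.

Lemma sipNl u v : B (- u) v = - B u v.
Proof. by rewrite -scaleN1r sipZl mulN1r. Qed.

Lemma sipBl u u' v : B (u - u') v = B u v - B u' v.
Proof. by rewrite sipDl sipNl. Qed.

Lemma sipDr u v v' : B u (v + v') = B u v + B u v'.
Proof. by rewrite !(sipC sB u) sipDl. Qed.

Lemma sipZr t u v : B u (t *: v) = t * B u v.
Proof. by rewrite !(sipC sB u) sipZl. Qed.

Lemma sipBr u v v' : B u (v - v') = B u v - B u v'.
Proof. by rewrite !(sipC sB u) sipBl. Qed.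

Lemma snorm_ge0 u : 0 <= nb u. Proof. exact: sqrtr_ge0. Qed.

Lemma snorm_sqr u : nb u ^+ 2 = B u u.
Proof. by rewrite sqr_sqrtr// (sip_ge0 sB). Qed.

Lemma snormZ t u : nb (t *: u) = `|t| * nb u.
Proof. by rewrite /snorm sipZl sipZr mulrA -expr2 sqrtrM ?sqr_ge0// sqrtr_sqr. Qed.

Lemma snormN u : nb (- u) = nb u.
Proof. by rewrite -scaleN1r snormZ normrN normr1 mul1r. Qed.

Lemma snormC u v : nb (u - v) = nb (v - u).
Proof. by rewrite -snormN opprB. Qed.

Lemma cauchy_schwarz u v : `|B u v| <= nb u * nb v.
Proof.
have h t : 0 <= B u u + 2 * t * B u v + t ^+ 2 * B v v.
  have := sip_ge0 sB (u + t *: v); rewrite sipDl !sipDr !sipZl !sipZr (sipC sB v u).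
  by congr (0 <= _); ring.
rewrite -(@ler_pXn2r _ 2)// ?nnegrE ?mulr_ge0 ?snorm_ge0// exprMn !snorm_sqr real_normK ?num_real//.
have Bu := sip_ge0 sB u; have := sip_ge0 sB v; rewrite le_eqVlt => /orP[/eqP v0|v0].
  rewrite -v0 mulr0; have [->|uv0] := eqVneq (B u v) 0; first by rewrite expr0n.
  (* When [B v v] is 0 the polynomial is affine in [t], and this [t] gives it the value -1. *)
  have := h (- (B u u + 1) / (2 * B u v)); rewrite -v0 mulr0 addr0.
  have -> : 2 * (- (B u u + 1) / (2 * B u v)) * B u v = - (B u u + 1) by field.
  by rewrite leNgt => /negP[]; lra.
have := h (- B u v / B v v).
have -> : B u u + 2 * (- B u v / B v v) * B u v + (- B u v / B v v) ^+ 2 * B v v =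
  B u u - B u v ^+ 2 / B v v by field; rewrite gt_eqF.
by rewrite subr_ge0 ler_pdivrMr.
Qed.

Lemma snormD u v : nb (u + v) <= nb u + nb v.
Proof.
rewrite -(@ler_pXn2r _ 2)// ?nnegrE ?addr_ge0 ?snorm_ge0// sqrrD !snorm_sqr.
rewrite sipDl !sipDr (sipC sB v u).
have := cauchy_schwarz u v; have := ler_norm (B u v); lra.
Qed.

Lemma snorm_dist u v : `|nb u - nb v| <= nb (u - v).
Proof.
rewrite ler_norml; apply/andP; split.
  have := snormD (v - u) u; rewrite subrK snormC; lra.
by have := snormD (u - v) v; rewrite subrK; lra.
Qed.

Lemma snorm_dual u C : 0 <= C -> (forall w, `|B u w| <= C * nb w) -> nb u <= C.
Proof.
move=> C0 /(_ u); rewrite ger0_norm ?(sip_ge0 sB)// -snorm_sqr expr2.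
have := snorm_ge0 u; rewrite le_eqVlt => /orP[/eqP<-//|u0].
by rewrite ler_pM2r.
Qed.

Section Convergence.
Context {T : Type} {F : set_system T} {FF : Filter F}.
Implicit Types (g : T -> V) (s : T -> R).

Lemma vcvg_snorm g l : vcvg B F g l -> nb (g t) @[t --> F] --> nb l.
Proof. rewrite /vcvg => gl; apply: (cvg_dist_le gl); apply: nearW => t; exact: snorm_dist. Qed.

Lemma vcvg_cst l : vcvg B F (fun=> l) l.
Proof. by rewrite /vcvg subrr /snorm sip0l sqrtr0; exact: cvg_cst. Qed.

Lemma vcvgD g g' l l' :
  vcvg B F g l -> vcvg B F g' l' -> vcvg B F (fun t => g t + g' t) (l + l').
Proof.
rewrite /vcvg => gl gl'; 
have h : nb (g t - l) + nb (g' t - l') @[t --> F] --> (0 : R).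
  by rewrite -(addr0 0); exact: cvgD.
apply: (cvg_dist_le h); apply: nearW => t.
by rewrite subr0 ger0_norm ?snorm_ge0// opprD addrACA snormD.
Qed.

Lemma vcvg_sum (I : Type) (r : seq I) (g : I -> T -> V) (l : I -> V) :
  (forall i, vcvg B F (g i) (l i)) ->
  vcvg B F (fun t => \sum_(i <- r) g i t) (\sum_(i <- r) l i).
Proof.
move=> gl; elim: r => [|i r IH].
  have -> : (fun t => \sum_(i <- [::]) g i t) = (fun=> 0 : V).
    by apply: funext => t; rewrite big_nil.
  by rewrite big_nil; exact: vcvg_cst.
have -> : (fun t => \sum_(j <- i :: r) g j t) = (fun t => g i t + \sum_(j <- r) g j t).
  by apply: funext => t; rewrite big_cons.
by rewrite big_cons; exact: vcvgD.
Qed.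

Lemma vcvgZ s g (a : R) l :
  s t @[t --> F] --> a -> vcvg B F g l -> vcvg B F (fun t => s t *: g t) (a *: l).
Proof.
rewrite /vcvg => sa gl.
have h : `|s t| * nb (g t - l) + `|s t - a| * nb l @[t --> F] --> (0 : R).
  have -> : 0 = `|a| * 0 + `|a - a| * nb l by rewrite subrr normr0 mulr0 mul0r addr0.
  apply: cvgD; first by apply: cvgM => //; exact: cvg_norm.
  by apply: cvgMr_tmp; apply: cvg_norm; apply: cvgB => //; exact: cvg_cst.
apply: (cvg_dist_le h); apply: nearW => t; rewrite subr0 ger0_norm ?snorm_ge0//.
have -> : s t *: g t - a *: l = s t *: (g t - l) + (s t - a) *: l.
  by rewrite scalerBr scalerBl addrA subrK.
by apply: le_trans (snormD _ _) _; rewrite !snormZ.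
Qed.

Lemma sip_cvg g g' l l' :
  vcvg B F g l -> vcvg B F g' l' -> B (g t) (g' t) @[t --> F] --> B l l'.
Proof.
move=> gl gl'; have := gl; have := gl'; rewrite /vcvg => glr gl'r.
have h : nb (g t - l) * nb (g' t) + nb l * nb (g' t - l') @[t --> F] --> (0 : R).
  have -> : 0 = 0 * nb l' + nb l * 0 by rewrite mulr0 mul0r addr0.
  by apply: cvgD; [apply: cvgM => //; exact: vcvg_snorm|exact: cvgMl_tmp].
apply: (cvg_dist_le h); apply: nearW => t.
have -> : B (g t) (g' t) - B l l' = B (g t - l) (g' t) + B l (g' t - l').
  by rewrite sipBl sipBr addrA subrK.
by apply: le_trans (ler_normD _ _) _; apply: lerD; exact: cauchy_schwarz.
Qed.

End Convergence.

(** The representative minimises [B v v - 2 * L v]: minimising sequences are Cauchy, and the first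
    variation vanishes at the limit. *)
Lemma riesz (L : V -> R) C : complete B ->
  (forall t v v', L (t *: v + v') = t * L v + L v') ->
  (forall v, `|L v| <= C * nb v) -> exists r, forall v, B r v = L v.
Proof.
move=> Bc Ll LC.
have LD v v' : L (v + v') = L v + L v' by rewrite -[v in LHS]scale1r Ll mul1r.
have L0 : L 0 = 0 by have := LD 0 0; rewrite addr0; lra.
have LZ t v : L (t *: v) = t * L v by rewrite -[t *: v]addr0 Ll L0 addr0.
pose I v := B v v - 2 * L v.
have Ilb v : - C ^+ 2 <= I v.
  rewrite /I -snorm_sqr; have := LC v; have := ler_norm (L v) => h1 h2.
  have : 0 <= (nb v - C) ^+ 2 by exact: sqr_ge0.
  rewrite sqrrB; lra.
pose S := range I.
have Sinf : has_inf S.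
  by split; [exists (I 0); exists 0|exists (- C ^+ 2) => _ [v _ <-]].
have mu_le v : inf S <= I v by apply: ge_inf; [exact: Sinf.2|exists v].
have /choice[v vP] : forall n : nat, exists v, I v < inf S + n.+1%:R^-1.
  move=> n; have n0 : 0 < n.+1%:R^-1 :> R by rewrite invr_gt0.
  by have [_ [v _ <-] h] := inf_adherent n0 Sinf; exists v.
(* Parallelogram identity, with [inf S] as a lower bound at the midpoint. *)
have par i j : nb (v i - v j) ^+ 2 <= 2 * i.+1%:R^-1 + 2 * j.+1%:R^-1.
  have := mu_le (2^-1 *: (v i + v j)); have := vP i; have := vP j.
  rewrite /I snorm_sqr sipZl sipZr LZ LD sipBl !sipBr sipDl !sipDr !(sipC sB (v j) (v i)).
  by move: (i.+1%:R^-1 : R) (j.+1%:R^-1 : R) => p q vj vi m; lra.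
have [r vr] : exists r, vcvg B \oo v r.
  apply: Bc => eps eps0.
  have e20 : 0 < eps ^+ 2 / 4 by rewrite divr_gt0// exprn_gt0.
  have [N _ NP] := near_infty_natSinv_lt (PosNum e20).
  exists N => i j Ni Nj; rewrite -(@ltr_pXn2r _ 2)// ?nnegrE ?snorm_ge0 ?ltW//.
  apply: le_lt_trans (par _ _) _; have := NP _ Ni; have := NP _ Nj => /=.
  by move: (i.+1%:R^-1 : R) (j.+1%:R^-1 : R) => p q h1 h2; lra.
exists r => w; apply: contrapT => /eqP; rewrite -subr_eq0 => ne.
have key t : 0 <= 2 * t * (B r w - L w) + t ^+ 2 * B w w.
  have c1 : 2 * t * (B (v n) w - L w) + t ^+ 2 * B w w + n.+1%:R^-1 @[n --> \oo] -->
      2 * t * (B r w - L w) + t ^+ 2 * B w w + (0 : R).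
    apply: cvgD; last exact: cvg_harmonic.
    apply: cvgD; last exact: cvg_cst.
    apply: cvgMl_tmp; apply: cvgB; last exact: cvg_cst.
    by apply: sip_cvg => //; exact: vcvg_cst.
  rewrite addr0 in c1; apply: (ler_cvg_to (@cvg_cst _ 0 _ _ _) c1).
  apply: nearW => n; have := mu_le (v n + t *: w); have := vP n.
  rewrite /I LD LZ !(sipDl, sipDr, sipZl, sipZr) (sipC sB w).
  by move: (n.+1%:R^-1 : R) => p vn m; lra.
(* Nearly the minimiser in [t]; the added 1 covers the case where [B w w] is 0. *)
have := key (- (B r w - L w) / (B w w + 1)).
set a := B r w - L w in ne *; have b0 := sip_ge0 sB w.
have -> : 2 * (- a / (B w w + 1)) * a + (- a / (B w w + 1)) ^+ 2 * B w w =
  - (a ^+ 2 * (B w w + 2) / (B w w + 1) ^+ 2).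
  by field; apply/eqP; lra.
have a2 : 0 < a ^+ 2 by rewrite exprn_even_gt0.
have p1 : 0 < B w w + 1 by lra.
have p2 : 0 < B w w + 2 by lra.
by rewrite oppr_ge0 leNgt divr_gt0//; [exact: mulr_gt0|exact: exprn_gt0].
Qed.

End Theory.
End SemiInnerProduct.

(** * Critical points of an even functional *)

Section Variational.
(** In the application [k u v] is the integral of u^(N-1) v with N = 2h + 2, called the mass of [u]
    when v = u, and [nn] is a sum of Lebesgue norms. [k_young] is the tangent inequality of the
    convex function [u |-> k u u]. *)
Variables (R : realType) (V : lmodType R) (B D k : V -> V -> R) (nn : V -> R) (h : nat).
Implicit Types (u v w : V).
Hypothesis sB : semi_inner B.
Hypothesis sD : semi_inner D.
Hypothesis Bc : complete B.
Variables (K1 K2 K3 : R).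
Hypotheses (K1_ge0 : 0 <= K1) (K2_ge0 : 0 <= K2) (K3_ge0 : 0 <= K3).
Hypothesis nn_ge0 : forall u, 0 <= nn u.
Hypothesis nn_le : forall u, nn u <= K1 * snorm B u.
Hypothesis D_le : forall u v, `|D u v| <= K2 * nn u * nn v.
Hypothesis k_lin : forall u t v v', k u (t *: v + v') = t * k u v + k u v'.
Hypothesis k_hom : forall t u v, k (t *: u) v = t ^+ h.*2.+1 * k u v.
Hypothesis k_ge0 : forall u, 0 <= k u u.
Hypothesis k_lip : forall u u' w,
  `|k u w - k u' w| <= K3 * (nn u + nn u') ^+ h.*2 * nn (u - u') * nn w.
Hypothesis k_young : forall u v,
  h.*2.+2%:R * k u v <= k v v + h.*2.+1%:R * k u u.
Hypothesis precompact : forall (g : nat -> V) C, (forall i, snorm B (g i) <= C) ->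
  exists2 s : nat -> nat, {homo s : m n / (m < n)%N} & vcauchy nn (g \o s).
Hypothesis coercive : forall Q0 J0 : R, exists C : R, forall u,
  B u u - D u u <= Q0 -> k u u <= J0 -> snorm B u <= C.

Local Notation nb := (snorm B).

Lemma k0l v : k 0 v = 0.
Proof. by rewrite -[0 in LHS](scale0r (0 : V)) k_hom exprS !mul0r. Qed.

Lemma kDr u v v' : k u (v + v') = k u v + k u v'.
Proof. by rewrite -[v in LHS]scale1r k_lin mul1r. Qed.

Lemma k0r u : k u 0 = 0.
Proof. by have := kDr u 0 0; rewrite addr0; lra. Qed.

Lemma kZr u t v : k u (t *: v) = t * k u v.
Proof. by rewrite -[t *: v]addr0 k_lin k0r addr0. Qed.

Lemma kNr u v : k u (- v) = - k u v.
Proof. by rewrite -scaleN1r kZr mulN1r. Qed.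

Lemma kNl u v : k (- u) v = - k u v.
Proof. by rewrite -scaleN1r k_hom -signr_odd /= odd_double expr1 mulN1r. Qed.

Lemma kBr u v v' : k u (v - v') = k u v - k u v'.
Proof. by rewrite kDr kNr. Qed.

Lemma kZZ t u : k (t *: u) (t *: u) = t ^+ h.*2.+2 * k u u.
Proof. by rewrite kZr k_hom mulrA -exprS. Qed.

(** A Lipschitz constant of [k] in its first argument, from [nn] to the dual of [B], between two
    points of norms [x] and [y]. *)
Definition klip_const (x y : R) := K3 * (K1 * x + K1 * y) ^+ h.*2 * K1.

Lemma klip_const_ge0 x y : 0 <= x -> 0 <= y -> 0 <= klip_const x y.
Proof. by move=> x0 y0; rewrite !mulr_ge0// exprn_ge0// addr_ge0// mulr_ge0. Qed.

Lemma k_lip_nn u u' w :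
  `|k u w - k u' w| <= klip_const (nb u) (nb u') * nn (u - u') * nb w.
Proof.
apply: le_trans (k_lip _ _ _) _.
have s0 : 0 <= nn u + nn u' by rewrite addr_ge0.
have pw : (nn u + nn u') ^+ h.*2 <= (K1 * nb u + K1 * nb u') ^+ h.*2.
  by rewrite lerXn2r// ?nnegrE ?(le_trans s0)// lerD.
have -> : klip_const (nb u) (nb u') * nn (u - u') * nb w =
  K3 * (K1 * nb u + K1 * nb u') ^+ h.*2 * nn (u - u') * (K1 * nb w).
  by rewrite /klip_const; ring.
apply: ler_pM => //; first by rewrite !mulr_ge0// exprn_ge0.
by rewrite ler_wpM2r// ler_wpM2l.
Qed.

Lemma k_le u w : `|k u w| <= klip_const (nb u) 0 * nn u * nb w.
Proof.
have := k_lip_nn u 0 w; rewrite k0l !subr0.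
by rewrite /snorm (sip0l sB) sqrtr0.
Qed.

Lemma klip_const_cvg {T : Type} {F : set_system T} {FF : Filter F} (f g : T -> R) a b :
  f t @[t --> F] --> a -> g t @[t --> F] --> b ->
  klip_const (f t) (g t) @[t --> F] --> klip_const a b.
Proof.
move=> fa gb; apply: cvgMr_tmp; apply: cvgMl_tmp.
apply: (@continuous_cvg _ _ _ F FF _ (fun x : R => x ^+ h.*2)).
  exact: exprn_continuous.
by apply: cvgD; apply: cvgMl_tmp.
Qed.

Lemma D_snorm u : snorm D u <= Num.sqrt K2 * K1 * nb u.
Proof.
rewrite /snorm -[K1]ger0_norm// -sqrtr_sqr -!sqrtrM ?mulr_ge0 ?sqr_ge0// ler_sqrt; last first.
  by rewrite !mulr_ge0 ?sqr_ge0// (sip_ge0 sB).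
apply: le_trans (ler_norm _) _; apply: le_trans (D_le _ _) _.
rewrite -(snorm_sqr sB) -mulrA -mulrA -exprMn ler_wpM2l// -expr2 lerXn2r// nnegrE//.
by rewrite mulr_ge0 ?snorm_ge0.
Qed.

Section Continuity.
Context {T : Type} {F : set_system T} {FF : Filter F}.
Implicit Types g : T -> V.

Lemma vcvgB_D g l : vcvg B F g l -> vcvg D F g l.
Proof.
rewrite /vcvg => gl.
have c : Num.sqrt K2 * K1 * nb (g t - l) @[t --> F] --> (0 : R).
  by rewrite -[X in _ --> X](mulr0 (Num.sqrt K2 * K1)); exact: cvgMl_tmp.
apply: (cvg_dist_le c); apply: nearW => t.
by rewrite subr0 ger0_norm ?snorm_ge0// D_snorm.
Qed.

Lemma D_cvg g g' l l' :
  vcvg B F g l -> vcvg B F g' l' -> D (g t) (g' t) @[t --> F] --> D l l'.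
Proof. by move=> /vcvgB_D gl /vcvgB_D gl'; exact: sip_cvg. Qed.

Lemma nn_cvg g l : vcvg B F g l -> nn (g t - l) @[t --> F] --> (0 : R).
Proof.
rewrite /vcvg => gl.
have c : K1 * nb (g t - l) @[t --> F] --> (0 : R).
  by rewrite -[X in _ --> X](mulr0 K1); exact: cvgMl_tmp.
by apply: (cvg_dist_le c); apply: nearW => t; rewrite subr0 ger0_norm.
Qed.

Lemma k_cvg g g' l l' :
  vcvg B F g l -> vcvg B F g' l' -> k (g t) (g' t) @[t --> F] --> k l l'.
Proof.
move=> gl gl'.
have c : klip_const (nb (g t)) (nb l) * nn (g t - l) * nb (g' t) +
    klip_const (nb l) 0 * nn l * nb (g' t - l') @[t --> F] --> (0 : R).
  rewrite -[X in _ --> X](_ : klip_const (nb l) (nb l) * 0 * nb l' +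
     klip_const (nb l) 0 * nn l * 0 = 0); last by rewrite !mulr0 mul0r addr0.
  apply: cvgD; last exact: cvgMl_tmp.
  apply: cvgM; last exact: vcvg_snorm.
  apply: cvgM; last exact: nn_cvg.
  by apply: klip_const_cvg; [exact: vcvg_snorm|exact: cvg_cst].
apply: (cvg_dist_le c); apply: nearW => t.
have -> : k (g t) (g' t) - k l l' = (k (g t) (g' t) - k l (g' t)) + k l (g' t - l').
  by rewrite kBr addrA subrK.
by apply: le_trans (ler_normD _ _) _; apply: lerD; [exact: k_lip_nn|exact: k_le].
Qed.

End Continuity.

Lemma D_repr : exists RD : V -> V, forall u v, B (RD u) v = D u v.
Proof.
suff /choice[RD RDE] : forall u, exists r, forall v, B r v = D u v by exists RD.
move=> u; apply: (@riesz _ _ _ sB (D u) (K2 * nn u * K1)) => // [t v v'|v].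
  by rewrite (sipDr sD) (sipZr sD).
by apply: le_trans (D_le _ _) _; rewrite -!mulrA ler_wpM2l// ler_wpM2l.
Qed.

Lemma k_repr : exists Rk : V -> V, forall u v, B (Rk u) v = k u v.
Proof.
suff /choice[Rk RkE] : forall u, exists r, forall v, B r v = k u v by exists Rk.
by move=> u; exact: (@riesz _ _ _ sB (k u) _ Bc (k_lin u) (k_le u)).
Qed.

(** * The energy-decreasing iteration and its critical points *)

Section Iteration.
Variables RD Rk : V -> V.
Hypothesis RDE : forall u v, B (RD u) v = D u v.
Hypothesis RkE : forall u v, B (Rk u) v = k u v.

(* step u minimises B v v - 2 * D u v over the hyperplane k u v = k u u, and
   mult u is the Lagrange multiplier. *)
Definition mult u := (k u u - k u (RD u)) / k u (Rk u).

Definition step u := RD u + mult u *: Rk u.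

Definition ray u := B u u - D u u.

(** The right-hand side involves only the weaker norm [nn], for which bounded sequences have Cauchy
    subsequences: this is the compactness of [RD], and likewise of [Rk] below. *)
Lemma RD_lip u u' : nb (RD u - RD u') <= K2 * K1 * nn (u - u').
Proof.
apply: (snorm_dual sB) => [|w]; first by rewrite !mulr_ge0.
rewrite (sipBl sB) !RDE -(sipBl sD); apply: le_trans (D_le _ _) _.
by rewrite -!mulrA ler_wpM2l// mulrCA ler_wpM2l.
Qed.

Lemma Rk_lip u u' : nb (Rk u - Rk u') <= klip_const (nb u) (nb u') * nn (u - u').
Proof.
apply: (snorm_dual sB) => [|w]; first by rewrite mulr_ge0 ?klip_const_ge0 ?snorm_ge0.
by rewrite (sipBl sB) !RkE; exact: k_lip_nn.
Qed.

Lemma k_Rk_gt0 u : 0 < k u u -> 0 < k u (Rk u).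
Proof.
move=> u0; rewrite -RkE lt_def (sip_ge0 sB) andbT; apply/eqP => r0.
have := cauchy_schwarz sB (Rk u) u; rewrite RkE {1}/snorm r0 sqrtr0 mul0r.
by rewrite normr_le0 gt_eqF.
Qed.

Lemma step_E u w : B (step u) w = D u w + mult u * k u w.
Proof. by rewrite (sipDl sB) (sipZl sB) RDE RkE. Qed.

Lemma k_step u : 0 < k u u -> k u (step u) = k u u.
Proof.
move=> /k_Rk_gt0 u0; rewrite kDr kZr /mult divfK ?gt_eqF//; ring.
Qed.

(** The two sides differ by [D (u - step u) (u - step u)]: the multiplier term disappears because
    [u] and [step u] lie on the same hyperplane [k u v = k u u]. *)
Lemma step_ray u : 0 < k u u -> B (u - step u) (u - step u) <= ray u - ray (step u).
Proof.
move=> u0; have := sip_ge0 sD (u - step u).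
rewrite /ray !(sipBl sB) !(sipBr sB) !(sipBl sD) !(sipBr sD) (sipC sB u (step u)).
rewrite !step_E (k_step u0) (sipC sD (step u) u); lra.
Qed.

(** [step u] lies on the hyperplane tangent at [u] to the level set of the mass, and a convex
    function lies above its tangent. *)
Lemma step_mass u : 0 < k u u -> k u u <= k (step u) (step u).
Proof.
move=> u0; have := k_young u (step u); rewrite (k_step u0).
by rewrite -[h.*2.+2%:R]natr1 mulrDl mul1r addrC lerD2r.
Qed.

Section StepContinuity.
Context {T : Type} {F : set_system T} {FF : Filter F}.
Implicit Types g : T -> V.

Lemma step_cvg g l : 0 < k l l -> vcvg B F g l -> vcvg B F (step \o g) (step l).
Proof.
move=> l0 gl.
have RDc : vcvg B F (RD \o g) (RD l).
  have c : K2 * K1 * nn (g t - l) @[t --> F] --> (0 : R).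
    by rewrite -[X in _ --> X](mulr0 (K2 * K1)); apply: cvgMl_tmp; exact: nn_cvg.
  apply: (cvg_dist_le c); apply: nearW => t.
  by rewrite subr0 ger0_norm ?snorm_ge0//; exact: RD_lip.
have Rkc : vcvg B F (Rk \o g) (Rk l).
  have c : klip_const (nb (g t)) (nb l) * nn (g t - l) @[t --> F] --> (0 : R).
    rewrite -[X in _ --> X](mulr0 (klip_const (nb l) (nb l))); apply: cvgM; last exact: nn_cvg.
    by apply: klip_const_cvg; [exact: vcvg_snorm|exact: cvg_cst].
  apply: (cvg_dist_le c); apply: nearW => t.
  by rewrite subr0 ger0_norm ?snorm_ge0//; exact: Rk_lip.
apply: vcvgD => //; apply: vcvgZ => //; apply: cvgM.
  by apply: cvgB; exact: k_cvg.
by apply: cvgV; [rewrite gt_eqF// k_Rk_gt0|exact: k_cvg].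
Qed.

Lemma iter_mass m u : 0 < k u u -> k u u <= k (iter m step u) (iter m step u).
Proof.
move=> u0; elim: m => //= m IH; apply: le_trans (step_mass _) => //.
exact: lt_le_trans IH.
Qed.

Lemma iter_cvg m g l : 0 < k l l -> vcvg B F g l ->
  vcvg B F (iter m step \o g) (iter m step l).
Proof.
move=> l0 gl; elim: m => //= m IH; apply: (step_cvg _ IH).
exact: lt_le_trans (iter_mass _ _).
Qed.

Lemma ray_cvg g l : vcvg B F g l -> ray (g t) @[t --> F] --> ray l.
Proof. by move=> gl; apply: cvgB; [exact: sip_cvg|exact: D_cvg]. Qed.

End StepContinuity.

(** Continuity of [step] along a constant sequence, which converges to every point at distance 0. *)
Lemma step_congr u u' : 0 < k u u -> nb (u' - u) = 0 -> nb (step u' - step u) = 0.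
Proof.
move=> u0 e; have c : vcvg B (\oo : set_system nat) (fun=> u') u.
  by rewrite /vcvg e; exact: cvg_cst.
have c' : nb (step u' - step u) @[_ --> (\oo : set_system nat)] --> (0 : R) by exact: step_cvg c.
by rewrite -(cvg_lim (@Rhausdorff R) c') lim_cst.
Qed.

(** [RD] and [Rk] are arbitrary choices of representatives, so they are odd only up to vectors of
    norm 0, and so is [step]. *)
Lemma stepN u : nb (step (- u) + step u) = 0.
Proof.
apply/eqP; rewrite eq_le snorm_ge0 andbT; apply: (snorm_dual sB) => // w.
have mN : mult (- u) = mult u.
  have a : k u (RD (- u)) = - k u (RD u).
    by rewrite -!RkE (sipC sB _ (RD _)) RDE (sipNl sD) -RDE (sipC sB (RD _)).
  have b : k u (Rk (- u)) = - k u (Rk u).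
    by rewrite -[LHS]RkE (sipC sB) RkE kNl -RkE.
  by rewrite /mult !kNl kNr a b !opprK.
by rewrite (sipDl sB) !step_E mN kNl (sipNl sD) mulrN addrACA !addNr addr0 normr0 mul0r.
Qed.

Lemma iterN m u : 0 < k u u -> nb (iter m step (- u) + iter m step u) = 0.
Proof.
move=> u0; elim: m => [|m IH] /=; first by rewrite addNr /snorm (sip0l sB) sqrtr0.
set v := iter m step (- u) in IH *; set w := iter m step u in IH *.
have w0 : 0 < k w w by exact: lt_le_trans (iter_mass _ _).
have := @step_congr (- w) v; rewrite kNl kNr !opprK => /(_ w0 IH) e.
have := stepN w => e'.
have := snormD sB (step v - step (- w)) (step (- w) + step w).
rewrite e e' addr0 addrA subrK => n0.
by apply/eqP; rewrite eq_le n0 snorm_ge0.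
Qed.

Variable beta : R.
Hypothesis beta_gt0 : 0 < beta.

(* ray u ^+ h.+1 / k u u is homogeneous of degree 0; low u says that it is below
   beta, or that ray u is negative. *)
Definition low u := ray u < 0 \/ ray u ^+ h.+1 < beta * k u u.

Lemma low_step u : 0 < k u u -> low u -> low (step u).
Proof.
move=> u0; have := step_ray u0; have := sip_ge0 sB (u - step u) => b0 r.
have rs : ray (step u) <= ray u by lra.
have [|s0] := ltP (ray (step u)) 0; first by left.
case=> [|ru]; first by move=> /(le_lt_trans rs); left.
right; apply: le_lt_trans (lt_le_trans ru _).
  by rewrite lerXn2r// nnegrE (le_trans s0).
by rewrite ler_pM2l// step_mass.
Qed.

Lemma low_iter m n u : 0 < k u u -> (m <= n)%N -> low (iter m step u) -> low (iter n step u).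
Proof.
move=> u0 /subnK <-; elim: (n - m)%N => //= d IH /IH; apply: low_step.
exact: lt_le_trans (iter_mass _ _).
Qed.

Lemma low_near {T : Type} {F : set_system T} {FF : Filter F} (g : T -> V) l :
  vcvg B F g l -> low l -> \forall t \near F, low (g t).
Proof.
move=> gl [l0|lb].
  have : \forall t \near F, ray (g t) < 0 by apply: (cvgr_lt (ray l)) => //; exact: ray_cvg.
  by apply: filterS => t ?; left.
have c : beta * k (g t) (g t) - ray (g t) ^+ h.+1 @[t --> F] --> beta * k l l - ray l ^+ h.+1.
  apply: cvgB; first by apply: cvgMl_tmp; exact: k_cvg.
  apply: (@continuous_cvg _ _ _ F FF _ (fun x : R => x ^+ h.+1)).
    exact: exprn_continuous.
  exact: ray_cvg.
have : \forall t \near F, 0 < beta * k (g t) (g t) - ray (g t) ^+ h.+1.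
  by apply: (cvgr_gt _ c); rewrite subr_gt0.
by apply: filterS => t; rewrite subr_gt0; right.
Qed.

Lemma klip_const_le (x y C : R) : 0 <= x <= C -> 0 <= y <= C -> klip_const x y <= klip_const C C.
Proof.
move=> /andP[x0 xC] /andP[y0 yC]; rewrite /klip_const ler_wpM2r// ler_wpM2l//.
have C0 := le_trans x0 xC.
by rewrite lerXn2r// ?nnegrE ?addr_ge0 ?mulr_ge0// lerD// ler_wpM2l.
Qed.

Lemma vcauchy_le (f g : nat -> V) K : 0 <= K ->
  (forall i j, nb (f i - f j) <= K * nn (g i - g j)) -> vcauchy nn g -> vcauchy nb f.
Proof.
move=> K0 fg gc eps eps0.
have Kp : 0 < K + 1 by lra.
have [|N NP] := gc (eps / (K + 1)); first by rewrite divr_gt0.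
exists N => i j Ni Nj; apply: le_lt_trans (fg _ _) _.
have := NP _ _ Ni Nj; rewrite ltr_pdivlMr// => h1.
by apply: le_lt_trans h1; rewrite mulrC ler_wpM2l//; lra.
Qed.

(** The energy of the iterates is nonnegative and decreasing, so it converges and consecutive
    iterates approach each other. A subsequence converges by compactness, and its limit is fixed by
    [step] in the sense that it solves the equation with the limit multiplier. *)
Lemma palais_smale u0 : 0 < k u0 u0 -> (forall m, ~ low (iter m step u0)) ->
  exists u l, [/\ 0 < k u u, forall w, B u w = D u w + l * k u w & ~ low u].
Proof.
move=> k0 nlow.
pose x m := iter m step u0.
have kx m : k u0 u0 <= k (x m) (x m) by exact: iter_mass.
have kx0 m : 0 < k (x m) (x m) by exact: lt_le_trans (kx m).
have rx0 m : 0 <= ray (x m) by rewrite leNgt; apply/negP => r; apply: (nlow m); left.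
have rk m : beta * k (x m) (x m) <= ray (x m) ^+ h.+1.
  by rewrite leNgt; apply/negP => r; apply: (nlow m); right.
have rS m : ray (x m.+1) <= ray (x m).
  by have := step_ray (kx0 m); have := sip_ge0 sB (x m - step (x m)); rewrite /x /=; lra.
have rni : nonincreasing_seq (ray \o x) by apply/nonincreasing_seqP.
have kni : nondecreasing_seq (fun m => k (x m) (x m)).
  by apply/nondecreasing_seqP => m; exact: step_mass.
have rle m : ray (x m) <= ray u0 by have := rni 0%N m (leq0n m).
(* An iterate that is not low has its mass controlled by its energy; together with [coercive] this
   bounds the norms. *)
have kle m : k (x m) (x m) <= ray u0 ^+ h.+1 / beta.
  rewrite ler_pdivlMr// mulrC; apply: le_trans (rk m) _.
  by rewrite lerXn2r ?nnegrE// (le_trans (rx0 m)).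
have [C CP] := coercive (ray u0) (ray u0 ^+ h.+1 / beta).
have {CP}xC m : nb (x m) <= C by apply: CP; [exact: rle|exact: kle].
have C0 : 0 <= C by apply: le_trans (xC 0%N); exact: snorm_ge0.
have [q rq] : exists q : R, ray (x m) @[m --> \oo] --> q.
  apply/cvg_ex; apply: nonincreasing_is_cvgn => //.
  by exists 0 => _ [m _ <-]; exact: rx0.
have [J kJ] : exists J : R, k (x m) (x m) @[m --> \oo] --> J.
  apply/cvg_ex; apply: nondecreasing_is_cvgn => //.
  by exists (ray u0 ^+ h.+1 / beta) => _ [m _ <-]; exact: kle.
have J0 : 0 < J.
  by apply: lt_le_trans k0 _; apply: (ler_cvg_to (cvg_cst _) kJ); exact: nearW.
have [s sh sc] := precompact xC.
have s_oo : s @ \oo --> \oo.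
  have si n : (n <= s n)%N by elim: n => // n IH; apply: leq_ltn_trans IH (sh _ _ _).
  by apply/cvgnyPge => A; exists A => // n /= An; exact: leq_trans (si n).
pose t := x \o s; pose v := step \o t.
have rt : ray (t j) @[j --> \oo] --> q.
  exact: (@cvg_comp _ _ _ s (fun m => ray (x m)) _ _ _ s_oo rq).
have rv : ray (v j) @[j --> \oo] --> q.
  have rq1 : ray (x m.+1) @[m --> \oo] --> q by rewrite (cvg_shiftS (ray \o x)).
  by exact: (@cvg_comp _ _ _ s (fun m => ray (x m.+1)) _ _ _ s_oo rq1).
have kt : k (t j) (t j) @[j --> \oo] --> J.
  exact: (@cvg_comp _ _ _ s (fun m => k (x m) (x m)) _ _ _ s_oo kJ).
(* By [step_ray], the squared distance is at most the drop in energy, which tends to 0. *)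
have tv : vcvg B \oo (fun j => t j - v j) 0.
  have c : ray (t j) - ray (v j) @[j --> \oo] --> (0 : R) by rewrite -(subrr q); exact: cvgB.
  have c2 : B (t j - v j) (t j - v j) @[j --> \oo] --> (0 : R).
    apply: (cvg_dist_le c); apply: nearW => j.
    by rewrite subr0 ger0_norm ?(sip_ge0 sB)//; apply: step_ray; exact: kx0.
  have c3 : Num.sqrt (B (t j - v j) (t j - v j)) @[j --> \oo] --> Num.sqrt 0.
    by apply: (continuous_cvg _ _ c2); exact: sqrt_continuous.
  rewrite sqrtr0 in c3; rewrite /vcvg.
  by under eq_cvg do rewrite subr0; exact: c3.
(* The equation of [step (t j)], tested against [t j], expresses the multiplier through convergent
   quantities. *)
have [l ml] : exists l : R, mult (t j) @[j --> \oo] --> l.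
  exists ((q - 0) / J).
  have mE j : mult (t j) = (ray (t j) - B (t j - v j) (t j)) / k (t j) (t j).
    rewrite (sipBl sB) step_E /ray; field.
    by rewrite gt_eqF//; exact: kx0.
  under eq_cvg do rewrite mE.
  apply: cvgM; last by apply: cvgV => //; rewrite gt_eqF.
  apply: cvgB => //.
  have c : nb (t j - v j) * C @[j --> \oo] --> (0 : R).
    rewrite -(mul0r C); apply: cvgMr_tmp; move: tv; rewrite /vcvg.
    by under eq_cvg do rewrite subr0.
  apply: (cvg_dist_le c); apply: nearW => j; rewrite subr0.
  apply: le_trans (cauchy_schwarz sB _ _) _; rewrite ler_wpM2l ?snorm_ge0//; exact: xC.
(* So far [t] is Cauchy for [nn] only. The compact maps [RD] and [Rk] make its images converge for
   [B], hence also [step \o t], and then [t] itself. *)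
have [rd rdP] : exists rd, vcvg B \oo (RD \o t) rd.
  apply: Bc; apply: (@vcauchy_le _ t (K2 * K1)) => //; first by rewrite mulr_ge0.
  by move=> i j; exact: RD_lip.
have [rk' rkP] : exists r, vcvg B \oo (Rk \o t) r.
  apply: Bc; apply: (@vcauchy_le _ t (klip_const C C)) => //; first exact: klip_const_ge0.
  move=> i j; apply: le_trans (Rk_lip _ _) _; rewrite ler_wpM2r//.
  by apply: klip_const_le; rewrite snorm_ge0 xC.
pose u := rd + l *: rk'.
have vu : vcvg B \oo v u by apply: vcvgD => //; exact: vcvgZ.
have tu : vcvg B \oo t u.
  have e : (fun j => t j - v j + v j) = t by apply: funext => j; rewrite subrK.
  by rewrite -e -[u]add0r; exact: vcvgD.
exists u, l; split.
- apply: lt_le_trans k0 _.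
  by apply: (ler_cvg_to (cvg_cst _) (k_cvg tu tu)); apply: nearW => j; exact: kx.
- move=> w.
  have c1 : B (v j) w @[j --> \oo] --> B u w by apply: sip_cvg => //; exact: vcvg_cst.
  have c2 : D (t j) w + mult (t j) * k (t j) w @[j --> \oo] --> D u w + l * k u w.
    apply: cvgD; first by apply: D_cvg => //; exact: vcvg_cst.
    by apply: cvgM => //; apply: k_cvg => //; exact: vcvg_cst.
  rewrite -(cvg_lim (@Rhausdorff R) c1) -(cvg_lim (@Rhausdorff R) c2).
  by congr (lim (_ @ \oo)); apply: funext => j; exact: step_E.
- move=> /(low_near tu)[N _ /(_ N (leqnn N))]; exact: nlow.
Qed.

Lemma k_le_nn u w : `|k u w| <= K3 * nn u ^+ h.*2.+1 * nn w.
Proof.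
have := k_lip u 0 w; rewrite k0l !subr0.
have n0 : nn 0 = 0.
  apply/eqP; rewrite eq_le nn_ge0 andbT; apply: le_trans (nn_le 0) _.
  by rewrite /snorm (sip0l sB) sqrtr0 mulr0.
by rewrite n0 addr0 -[K3 * _ * nn u]mulrA -exprSr.
Qed.

Lemma rayZ t u : ray (t *: u) = t ^+ 2 * ray u.
Proof. by rewrite /ray (sipZl sB) (sipZr sB) (sipZl sD) (sipZr sD); ring. Qed.

Lemma lowZ t u : t != 0 -> low u -> low (t *: u).
Proof.
move=> t0; have t2 : 0 < t ^+ 2 by rewrite exprn_even_gt0.
rewrite /low rayZ kZZ => -[r0|r]; first by left; rewrite pmulr_rlt0.
right; rewrite exprMn -exprM mul2n doubleS mulrCA ltr_pM2l//.
by rewrite -doubleS -mul2n exprM exprn_gt0.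
Qed.

Lemma unit_mass u : 0 < k u u -> exists2 t, t != 0 & k (t *: u) (t *: u) = 1.
Proof.
move=> u0; exists (k u u `^ (- h.*2.+2%:R^-1)); first by rewrite gt_eqF// powR_gt0.
rewrite kZZ -powR_mulrn ?powR_ge0// -powRrM mulNr mulVf ?pnatr_eq0//.
by rewrite powR_inv1 ?ltW// mulVf// gt_eqF.
Qed.

(* The low vectors have finite genus: they are mapped away from 0 by finitely
   many linear forms. *)
Lemma low_separated : exists l : seq V, forall u, 0 < k u u -> low u ->
  exists2 i, (i < size l)%N & k l`_i u != 0.
Proof.
apply: contrapT => no.
(* Otherwise any finite list of forms vanishes at some low vector, which homogeneity allows to
   normalise to mass 1. *)
have /choice[c cP] : forall l : seq V, exists u, [/\ k u u = 1, low u &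
    forall i, (i < size l)%N -> k l`_i u = 0].
  move=> l; apply: contrapT => nu; apply: no; exists l => u u0 ul.
  apply: contrapT => ni; apply: nu; have [t t0 t1] := unit_mass u0.
  exists (t *: u); split=> //; first exact: lowZ.
  move=> i il; rewrite kZr; apply/eqP; rewrite mulf_eq0 (negbTE t0) /=.
  by apply/negP => /negP ki; apply: ni; exists i.
(* [G n] lists the first n terms of a sequence [g] of low vectors of mass 1, each in the kernel of
   the forms [k (g i)] of the earlier ones. *)
pose G := fix G n := if n is m.+1 then rcons (G m) (c (G m)) else [::].
pose g n := c (G n).
have szG n : size (G n) = n by elim: n => //= n IH; rewrite size_rcons IH.
have GE n i : (i < n)%N -> (G n)`_i = g i.
  elim: n => // n IH; rewrite ltnS leq_eqVlt /= nth_rcons szG => /orP[/eqP->|il].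
    by rewrite ltnn eqxx.
  by rewrite il IH.
have g1 n : k (g n) (g n) = 1 by have [] := cP (G n).
have gl n : low (g n) by have [] := cP (G n).
have g0 i n : (i < n)%N -> k (g i) (g n) = 0.
  by move=> il; have [_ _ /(_ i)] := cP (G n); rewrite szG GE//; apply.
(* At mass 1, a low vector has [ray ^+ h.+1] below [beta] or [ray] negative; both exclude [ray]
   above 1 + beta. *)
have [C CP] := coercive (1 + beta) 1.
have gC n : nb (g n) <= C.
  apply: CP; last by rewrite g1.
  rewrite -/(ray _) leNgt; apply/negP => r1.
  case: (gl n) => [r0|]; first by move: (lt_trans r1 r0); apply/negP; rewrite -leNgt addr_ge0// ltW.
  rewrite g1 mulr1; apply/negP; rewrite -leNgt.
  have b0 : 0 < beta by [].
  have r2 : 1 <= ray (g n) by lra.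
  have r0 : 0 <= ray (g n) by lra.
  have r3 : beta <= ray (g n) by lra.
  by apply: (le_trans r3); rewrite exprS ler_peMr// exprn_ege1.
have C0 : 0 <= C by apply: le_trans (gC 0%N); exact: snorm_ge0.
have [s sh sc] := precompact gC.
set K := K3 * (K1 * C) ^+ h.*2.+1.
have K0 : 0 <= K by rewrite mulr_ge0// exprn_ge0// mulr_ge0.
have [|N NP] := sc (K + 1)^-1; first by rewrite invr_gt0; lra.
have := NP _ _ (leqnn N) (leqnSn N); rewrite /= => small.
(* This pairing equals 1 by the choice of [g], but is less than 1 because the subsequence is Cauchy
   for [nn]. *)
have := k_le_nn (g (s N)) (g (s N) - g (s N.+1)).
rewrite kBr g1 g0 ?sh// subr0 normr1; apply/negP; rewrite -ltNge.
have nK : K3 * nn (g (s N)) ^+ h.*2.+1 <= K.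
  rewrite ler_wpM2l// lerXn2r// ?nnegrE ?mulr_ge0//.
  by apply: le_trans (nn_le _) _; rewrite ler_wpM2l.
apply: le_lt_trans (ler_wpM2r (nn_ge0 _) nK) _.
apply: le_lt_trans (ler_wpM2l K0 (ltW small)) _.
by rewrite ltr_pdivrMr ?mul1r; lra.
Qed.

Hypothesis independent : forall n, exists e : 'I_n -> V,
  forall x : 'rV[R]_n, x != 0 -> 0 < k (\sum_j x ord0 j *: e j) (\sum_j x ord0 j *: e j).

Lemma exists_high_critical :
  exists u l, [/\ 0 < k u u, forall w, B u w = D u w + l * k u w & ~ low u].
Proof.
apply: contrapT => nocrit.
have [l lP] := low_separated.
(* One dimension more than the number of separating forms, as Borsuk-Ulam requires. *)
have [e eP] := independent (size l).+1.
pose P := 'rV[R]_(size l).+1.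
pose U (x : P) := \sum_j x ord0 j *: e j.
have Uc (x : P) : vcvg B (nbhs x) U (U x).
  apply: (vcvg_sum sB) => j; apply: (vcvgZ sB); last exact: (vcvg_cst sB).
  exact: (@coord_continuous R _ _ ord0 j).
have U0 (x : P) : l1 x = 1 -> 0 < k (U x) (U x).
  move=> x1; apply: eP; apply/eqP => x0; move: x1.
  rewrite x0 /l1 big1; first by move/esym/eqP; rewrite oner_eq0.
  by move=> j _; rewrite mxE normr0.
have UN (x : P) : U (- x) = - U x.
  by rewrite /U -sumrN; apply: eq_bigr => j _; rewrite mxE scaleNr.
(* Each point of the sphere becomes low after some number of steps, by [palais_smale]. Being low is
   an open condition and persists under [step], so compactness makes that number uniform. *)
have [m mP] : exists m, forall x : P, l1 x = 1 -> low (iter m step (U x)).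
  apply: contrapT => nm.
  have /choice[y yP] : forall m, exists y : P, l1 y = 1 /\ ~ low (iter m step (U y)).
    move=> m; apply: contrapT => ny; apply: nm; exists m => x x1.
    by apply: contrapT => nx; apply: ny; exists x.
  have y1 n : l1 (y n) = 1 by have [] := yP n.
  have [x [x1 xc]] : [set x : P | l1 x = 1] `&` cluster (y @ \oo) !=set0.
    apply: sphere_compact.
    exact: (@filterE nat \oo _ (fun M => l1 (y M) = 1) y1).
  have [m lm] : exists m, low (iter m step (U x)).
    apply: contrapT => nl; apply: nocrit; apply: (@palais_smale (U x)); first exact: U0.
    by move=> m lm; apply: nl; exists m.
  have nx : nbhs x [set z | low (iter m step (U z))].
    exact: low_near (iter_cvg m (U0 _ x1) (Uc x)) lm.
  have ny : (y @ \oo) [set z | exists2 n, (m <= n)%N & z = y n].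
    by exists m; [by []|move=> n mn; exists n].
  have [z [[n mn ->] /= ly]] := xc _ _ ny nx.
  have [_ nly] := yP n; apply: nly; exact: (low_iter (U0 _ (y1 n)) mn ly).
pose f i x := k l`_i (iter m step (U x)).
(* Exactly odd, although the iterates are odd only up to norm 0: by [k_le] the form [k] vanishes on
   vectors of norm 0. *)
have fN i (x : P) : (i < size l)%N -> l1 x = 1 -> f i (- x) = - f i x.
  move=> _ x1; rewrite /f UN; apply/eqP; rewrite -addr_eq0 -kDr.
  have := k_le l`_i (iter m step (- U x) + iter m step (U x)).
  by rewrite (iterN m (U0 _ x1)) mulr0 normr_le0.
have fc i (x : P) : (i < size l)%N -> l1 x = 1 -> {for x, continuous (f i)}.
  move=> _ x1.
  exact: (@k_cvg _ (nbhs x) _ (fun=> l`_i) (fun y => iter m step (U y)) _ _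
    (vcvg_cst sB _) (iter_cvg m (U0 _ x1) (Uc x))).
have [x x1 x0] := borsuk_ulam fN fc.
have [i il] := lP _ (lt_le_trans (U0 _ x1) (iter_mass m (U0 _ x1))) (mP _ x1).
by rewrite -/(f i x) x0 ?eqxx.
Qed.

End Iteration.

Hypothesis h_gt0 : (0 < h)%N.
Hypothesis independent : forall n, exists e : 'I_n -> V,
  forall x : 'rV[R]_n, x != 0 -> 0 < k (\sum_j x ord0 j *: e j) (\sum_j x ord0 j *: e j).

(** A critical point that is not low has positive energy, hence a positive multiplier, which
    rescaling normalises to 1. The mass of the solution to the power [h] is then
    [ray u ^+ h.+1 / k u u], at least [beta]. *)
Theorem high_energy_solution beta :
  exists2 w, forall v, B w v - D w v = k w v & beta <= k w w ^+ h.
Proof.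
wlog beta0 : beta / 0 < beta.
  move=> /(_ (`|beta| + 1))[|w ? hw]; first by have := normr_ge0 beta; lra.
  by exists w => //; apply: le_trans hw; have := ler_norm beta; lra.
have [RD RDE] := D_repr; have [Rk RkE] := k_repr.
have [u [l [u0 uE nl]]] := exists_high_critical RDE RkE beta0 independent.
have rE : ray u = l * k u u by rewrite /ray uE; ring.
have r0 : 0 <= ray u by rewrite leNgt; apply/negP => r; apply: nl; left.
have rk : beta * k u u <= ray u ^+ h.+1 by rewrite leNgt; apply/negP => r; apply: nl; right.
have l0 : 0 < l.
  have : 0 < ray u ^+ h.+1 by apply: lt_le_trans rk; rewrite mulr_gt0.
  rewrite lt0r expf_eq0 /= => /andP[rn _].
  have : 0 < ray u by rewrite lt_def rn.
  by rewrite rE pmulr_lgt0.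
(* The left side of the equation has degree 1 and [k] has degree 2h + 1 in [u]. *)
pose s := l `^ h.*2%:R^-1.
have sE : s ^+ h.*2 = l.
  rewrite -powR_mulrn ?powR_ge0// -powRrM mulVf ?powRr1 ?ltW//.
  by rewrite pnatr_eq0 double_eq0 -lt0n.
exists (s *: u) => [v|].
  by rewrite (sipZl sB) (sipZl sD) k_hom exprS sE uE; ring.
have kE : k (s *: u) (s *: u) ^+ h = l ^+ h.+1 * k u u ^+ h.
  rewrite kZZ exprMn -exprM -doubleS -mul2n mulnAC mul2n exprM sE.
  by [].
rewrite kE -(ler_pM2r u0) -mulrA -exprSr -exprMn -rE.
exact: rk.
Qed.

End Variational.

(** * Lebesgue norms *)

Section Lq.
Context d (T : measurableType d) (R : realType) (mu : {measure set T -> \bar R}).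
Implicit Types (f g u v : T -> R) (q r s t : R).

Definition itg f := mu.-integrable setT (EFin \o f).
(** An infinite norm is sent to 0, so that estimates need membership in [Lfun]. *)
Definition Nq q f : R := fine ('N[mu]_(q%:E)[EFin \o f])%E.
Local Notation I := (Rintegral mu setT).

Lemma Lfun_measurable p f : f \in Lfun mu p -> measurable_fun setT f.
Proof. by move=> /andP[/[!inE]]. Qed.

Lemma measurable_powR_norm f r : measurable_fun setT f ->
  measurable_fun setT (fun x => `|f x| `^ r).
Proof.
move=> mf; apply: (@measurableT_comp _ _ _ _ _ _ (@powR R ^~ r)) => //.
exact: measurableT_comp.
Qed.

Lemma Nq_ge0 q f : 0 <= Nq q f.
Proof. by rewrite fine_ge0// Lnorm_ge0. Qed.

Lemma NqE q f : f \in Lfun mu q%:E -> (Nq q f)%:E = 'N[mu]_(q%:E)[EFin \o f]%E.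
Proof.
move=> /andP[_]; rewrite inE /= /finite_norm => fq.
by rewrite /Nq fineK// ge0_fin_numE ?Lnorm_ge0.
Qed.

Lemma Nq_powR q f : 1 <= q -> f \in Lfun mu q%:E ->
  Nq q f `^ q = I (fun x => `|f x| `^ q).
Proof.
move=> q1 fq; apply: EFin_inj; rewrite -poweR_EFin (NqE fq).
rewrite powR_Lnorm ?gt_eqF ?(lt_le_trans ltr01)//.
rewrite fineK; first by apply: eq_integral => x _.
exact/integrable_fin_num/Lfun_integrable.
Qed.

Lemma LfunP_powR q f : 1 <= q -> measurable_fun setT f -> itg (fun x => `|f x| `^ q) ->
  f \in Lfun mu q%:E.
Proof.
move=> q1 mf /integrableP[_ fi]; apply/andP; split; rewrite inE//=.
rewrite /finite_norm unlock poweR_lty//; apply: le_lt_trans fi.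
rewrite le_eqVlt; apply/orP; left; apply/eqP; apply: eq_integral => x _ /=.
by rewrite (ger0_norm (powR_ge0 _ _)).
Qed.

Lemma NqD q f g : 1 <= q -> f \in Lfun mu q%:E -> g \in Lfun mu q%:E ->
  Nq q (f + g) <= Nq q f + Nq q g.
Proof.
move=> q1 fq gq; rewrite -lee_fin EFinD !NqE//; last first.
  have qe : (1 <= q%:E)%E by rewrite lee_fin.
  exact: (@Lfun_addr_closed _ _ _ mu _ qe).2.
by apply: minkowski_EFin => //; [exact: (Lfun_measurable fq)|exact: (Lfun_measurable gq)].
Qed.

Lemma NqZ q a f : 1 <= q -> f \in Lfun mu q%:E -> Nq q (a *: f) = `|a| * Nq q f.
Proof.
move=> q1 fq; have qe : (1 <= q%:E)%E by rewrite lee_fin.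
rewrite /Nq -[f](Lfun_valP qe fq) LnormZ fineM//.
by rewrite -NqE// LfunP.
Qed.

Lemma hoelder_itg r s f g : 1 < r -> 1 < s -> r^-1 + s^-1 = 1 ->
  f \in Lfun mu r%:E -> g \in Lfun mu s%:E ->
  itg (fun x => f x * g x) /\ I (fun x => `|f x * g x|) <= Nq r f * Nq s g.
Proof.
move=> r1 s1 rs fr gs; have mf := Lfun_measurable fr; have mg := Lfun_measurable gs.
have h : ('N[mu]_1[EFin \o (f \* g)%R] <= (Nq r f * Nq s g)%R%:E)%E.
  rewrite EFinM !NqE//; apply: hoelder => //; exact: lt_trans ltr01 _.
have mfg : measurable_fun setT (fun x => f x * g x) by exact: measurable_funM.
rewrite Lnorm1 in h; split.
  apply/integrableP; split; first exact/measurable_EFinP.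
  exact: le_lt_trans h (ltry _).
rewrite -lee_fin fineK//; rewrite ge0_fin_numE ?integral_ge0//.
exact: le_lt_trans h (ltry _).
Qed.

Lemma itg_le f g : measurable_fun setT f -> (forall x, `|f x| <= g x) -> itg g -> itg f.
Proof.
move=> mf fg; apply: le_integrable => //; first exact/measurable_EFinP.
by move=> x _ /=; rewrite lee_fin (le_trans (fg x))// ler_norm.
Qed.

Lemma itgD f g : itg f -> itg g -> itg (fun x => f x + g x).
Proof. exact: integrableD. Qed.

Lemma itgZ a f : itg f -> itg (fun x => a * f x).
Proof. exact: integrableZl. Qed.

Lemma Lfun_powR t s f : 0 < t -> 1 <= s -> 1 <= s * t -> f \in Lfun mu (s * t)%:E ->
  (fun x => `|f x| `^ t) \in Lfun mu s%:E /\
  Nq s (fun x => `|f x| `^ t) = Nq (s * t) f `^ t.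
Proof.
move=> t0 s1 st1 fst; have mf := Lfun_measurable fst.
have pE x : `| `|f x| `^ t| `^ s = `|f x| `^ (s * t).
  by rewrite ger0_norm ?powR_ge0// -powRrM mulrC.
have fl : (fun x => `|f x| `^ t) \in Lfun mu s%:E.
  apply: LfunP_powR => //; first exact: measurable_powR_norm.
  by rewrite /itg; under eq_fun do rewrite /= pE; exact: Lfun_integrable.
split=> //.
have s0 : s != 0 by rewrite gt_eqF// (lt_le_trans ltr01).
have -> : Nq s (fun x => `|f x| `^ t) = (Nq s (fun x => `|f x| `^ t) `^ s) `^ s^-1.
  by rewrite -powRrM mulfV// powRr1// Nq_ge0.
rewrite (Nq_powR s1 fl).
under eq_Rintegral do rewrite pE.
rewrite -(Nq_powR st1 fst) -powRrM; congr (_ `^ _).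
by rewrite mulrAC mulfV// mul1r.
Qed.

Lemma powR2_norm (x : R) : `|x| `^ 2 = x ^+ 2.
Proof. by rewrite powR_mulrn// real_normK// num_real. Qed.

(** For finite p this is Hölder's inequality and q is twice the conjugate exponent; for infinite p,
    [a] is essentially bounded and q = 2. *)
Lemma potential_bound (p : \bar R) (a : T -> R) : (1 < p)%E -> a \in Lfun mu p ->
  exists (q A : R), [/\ 2 <= q, 0 <= A & forall u, u \in Lfun mu q%:E ->
    itg (fun x => `|a x| * u x ^+ 2) /\ I (fun x => `|a x| * u x ^+ 2) <= A * Nq q u ^+ 2].
Proof.
case: p => [r| |]//; last first.
  move=> _ ay; have ma := Lfun_measurable ay.
  have [M M0 aM] : exists2 M : R, 0 <= M & {ae mu, forall x, `|a x| <= M}.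
    have [mu0|mu0] := ltP 0%E (mu setT); last first.
      exists 0 => //; exists setT; split => //.
      by apply/eqP; rewrite eq_le mu0 measure_ge0.
    move: ay => /andP[_]; rewrite inE /= /finite_norm unlock mu0 => ny.
    exists `|fine (ess_sup mu (abse \o (EFin \o a)))| => //.
    have := ess_sup_ge mu (abse \o (EFin \o a)); apply: filterS => x /= ax.
    rewrite -lee_fin; apply: le_trans ax _.
    move: ny; case: (ess_sup _ _) => [y| |]/= ny.
    - by rewrite lee_fin ler_norm.
    - by move: ny; rewrite ltxx.
    - by rewrite leNye.
  exists 2, M; split => // u u2.
  have [u2i u2E] : itg (fun x => u x ^+ 2) /\ I (fun x => u x ^+ 2) = Nq 2 u ^+ 2.
    have eF : (fun x => `|u x| `^ 2) = (fun x => u x ^+ 2).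
      by apply: funext => x; rewrite powR2_norm.
    split; last by rewrite -powR_mulrn ?Nq_ge0// (Nq_powR _ u2) ?ler1n// eF.
    by rewrite /itg -eF; exact: (Lfun_integrable (ler1n R 2) u2).
  have mu_ := Lfun_measurable u2.
  have mau : measurable_fun setT (fun x => `|a x| * u x ^+ 2).
    apply: measurable_funM; first exact: measurableT_comp.
    exact: measurable_funX.
  have le : (\int[mu]_x (`|a x| * u x ^+ 2)%:E <= \int[mu]_x (M * u x ^+ 2)%:E)%E.
    apply: ae_ge0_le_integral => //.
    - by move=> x _; rewrite lee_fin mulr_ge0 ?sqr_ge0.
    - exact/measurable_EFinP.
    - by move=> x _; rewrite lee_fin mulr_ge0 ?sqr_ge0.
    - apply/measurable_EFinP/measurable_funM; first exact: measurable_cst.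
      exact: measurable_funX.
    - by apply: filterS aM => x aM _; rewrite lee_fin ler_wpM2r ?sqr_ge0.
  have Mi := itgZ M u2i.
  have fin : (\int[mu]_x (M * u x ^+ 2)%:E)%E \is a fin_num by exact: integrable_fin_num.
  have aui : itg (fun x => `|a x| * u x ^+ 2).
    apply/integrableP; split; first exact/measurable_EFinP.
    apply: le_lt_trans (_ : (_ <= \int[mu]_x (M * u x ^+ 2)%:E)%E) _; last by rewrite ltey_eq fin.
    apply: le_trans le; rewrite le_eqVlt; apply/orP; left; apply/eqP.
    by apply: eq_integral => x _ /=; rewrite ger0_norm// mulr_ge0 ?sqr_ge0.
  split=> //; rewrite -u2E -RintegralZl//.
  by rewrite /Rintegral fine_le//; exact: integrable_fin_num.
rewrite lte_fin => r1 ar.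
have r0 : 0 < r - 1 by lra.
pose s := r / (r - 1).
have s1 : 1 < s by rewrite /s ltr_pdivlMr//; lra.
have rs : r^-1 + s^-1 = 1 by rewrite /s; field; apply/andP; split; apply/eqP; lra.
have q2 : 2 <= s * 2 by lra.
exists (s * 2), (Nq r a); split=> //; first exact: Nq_ge0.
move=> u uq; have [|||u2 u2E] := @Lfun_powR 2 s u _ _ _ uq; [by []|lra|lra|].
have := hoelder_itg r1 s1 rs ar u2; rewrite u2E powR_mulrn ?Nq_ge0// => -[i1 i2].
have e x : `|a x| * u x ^+ 2 = `|a x * `|u x| `^ 2|.
  by rewrite normrM powR2_norm [`|_ ^+ 2|]ger0_norm ?sqr_ge0.
split; last by under eq_Rintegral do rewrite e.
apply: itg_le (_ : itg (fun x => `|a x * `|u x| `^ 2|)).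
- apply: measurable_funM; first exact: (measurableT_comp _ (Lfun_measurable ar)).
  exact/measurable_funX/(Lfun_measurable uq).
- by move=> x; rewrite -e ger0_norm// mulr_ge0 ?sqr_ge0.
- exact: integrable_norm i1.
Qed.

(** Hölder's inequality for |u| times |u|^(q-1), with N and its conjugate exponent. Once the L^N
    norm is bounded, the power q - 1 on the right, less than q, lets the energy absorb the
    potential. *)
Lemma interpolation N q u : 2 <= N -> 2 <= q ->
  u \in Lfun mu N%:E -> u \in Lfun mu q%:E -> u \in Lfun mu (N / (N - 1) * (q - 1))%:E ->
  Nq q u `^ q <= Nq N u * Nq (N / (N - 1) * (q - 1)) u `^ (q - 1).
Proof.
move=> N2 q2 uN uq ur.
have N1 : 0 < N - 1 by lra.
pose s := N / (N - 1).
have s1 : 1 < s by rewrite /s ltr_pdivlMr//; lra.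
have Ns : N^-1 + s^-1 = 1 by rewrite /s; field; apply/andP; split; apply/eqP; lra.
have sq : 1 <= s * (q - 1) by rewrite -[leLHS]mulr1 ler_pM//; lra.
have [|||v1 vE] := @Lfun_powR (q - 1) s u _ _ _ ur; [lra|lra|by []|].
have N1' : 1 < N by lra.
have [_] := hoelder_itg N1' s1 Ns uN v1.
rewrite vE -/s (Nq_powR _ uq); last lra.
apply: le_trans; rewrite le_eqVlt; apply/orP; left; apply/eqP.
apply: eq_Rintegral => x _; rewrite normrM [X in _ * X]ger0_norm ?powR_ge0//.
by rewrite mulr_powRB1//; lra.
Qed.

Section NatPower.
Variable n : nat.
Local Notation N := n.+2.

Lemma Lfun_natpow u : u \in Lfun mu N%:R%:E ->
  itg (fun x => `|u x| ^+ N) /\ I (fun x => `|u x| ^+ N) = Nq N%:R u ^+ N.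
Proof.
move=> uN; have N1 : 1 <= N%:R :> R by rewrite ler1n.
have eF : (fun x => `|u x| `^ N%:R) = (fun x => `|u x| ^+ N).
  by apply: funext => x; rewrite powR_mulrn.
split; last by rewrite -powR_mulrn ?Nq_ge0// (Nq_powR N1 uN) eF.
by rewrite /itg -eF; exact: (Lfun_integrable N1 uN).
Qed.

(** Hölder's inequality with exponents N, N / n and N, up to a harmless factor 3 left by the
    elementary proof. *)
Lemma trilinear_itg f g v : f \in Lfun mu N%:R%:E -> g \in Lfun mu N%:R%:E ->
  v \in Lfun mu N%:R%:E ->
  itg (fun x => `|f x| * `|g x| ^+ n * `|v x|) /\
  I (fun x => `|f x| * `|g x| ^+ n * `|v x|) <=
  3 * (Nq N%:R f * Nq N%:R g ^+ n * Nq N%:R v).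
Proof.
move=> fN gN vN.
have [fi fE] := Lfun_natpow fN; have [gi gE] := Lfun_natpow gN; have [vi vE] := Lfun_natpow vN.
(* The pointwise bound below is made homogeneous by scaling each function by
   (almost) its norm. *)
have pt (x y z : R) : 0 <= x -> 0 <= y -> 0 <= z ->
    x * y ^+ n * z <= x ^+ N + y ^+ N + z ^+ N.
  move=> x0 y0 z0; set t := Num.max x (Num.max y z).
  have [xt yt zt] : [/\ x <= t, y <= t & z <= t].
    by rewrite /t !le_max !lexx !orbT.
  have : x * y ^+ n * z <= t ^+ N.
    have -> : t ^+ N = t * t ^+ n * t by rewrite -exprS -exprSr.
    apply: ler_pM => //; first by rewrite mulr_ge0// exprn_ge0.
    by apply: ler_pM; rewrite ?exprn_ge0// lerXn2r// nnegrE (le_trans x0).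
  move/le_trans; apply.
  have px := exprn_ge0 N x0; have py := exprn_ge0 N y0; have pz := exprn_ge0 N z0.
  have : t ^+ N \in [:: x ^+ N; y ^+ N; z ^+ N].
    by rewrite /t; case: (leP y z) => _; case: leP => _; rewrite !inE eqxx ?orbT.
  by rewrite !inE => /or3P[] /eqP->; lra.
have mprod : measurable_fun setT (fun x => `|f x| * `|g x| ^+ n * `|v x|).
  apply: measurable_funM; last exact: (measurableT_comp _ (Lfun_measurable vN)).
  apply: measurable_funM; first exact: (measurableT_comp _ (Lfun_measurable fN)).
  by apply: measurable_funX; exact: (measurableT_comp _ (Lfun_measurable gN)).
have ii : itg (fun x => `|f x| * `|g x| ^+ n * `|v x|).
  apply: itg_le mprod _ (itgD (itgD fi gi) vi) => x.
  by rewrite ger0_norm ?mulr_ge0 ?exprn_ge0//; exact: pt.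
split=> //.
have key al be ga : 0 < al -> 0 < be -> 0 < ga ->
    Nq N%:R f <= al -> Nq N%:R g <= be -> Nq N%:R v <= ga ->
    I (fun x => `|f x| * `|g x| ^+ n * `|v x|) <= 3 * (al * be ^+ n * ga).
  move=> al0 be0 ga0 fal gbe vga.
  have bn0 := exprn_gt0 n be0.
  have c0 : 0 < al * be ^+ n * ga by rewrite !mulr_gt0.
  rewrite [leRHS]mulrC -ler_pdivrMl//.
  rewrite -RintegralZl//.
  have si u ep : 0 < ep -> itg (fun x => `|u x| ^+ N) ->
     I (fun x => `|u x| ^+ N) = Nq N%:R u ^+ N ->
     Nq N%:R u <= ep ->
     itg (fun x => ep^-1 ^+ N * `|u x| ^+ N) /\ I (fun x => ep^-1 ^+ N * `|u x| ^+ N) <= 1.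
    move=> ep0 ui uE ue; split; first exact: itgZ. have e0 := ltW ep0.
    rewrite RintegralZl// uE -exprMn exprn_ile1// ?mulr_ge0 ?invr_ge0 ?Nq_ge0//.
    by rewrite ler_pdivrMl// mulr1.
  have [f1 f2] := si _ _ al0 fi fE fal; have [g1 g2] := si _ _ be0 gi gE gbe.
  have [v1 v2] := si _ _ ga0 vi vE vga.
  apply: (@le_trans _ _ (I (fun x => al^-1 ^+ N * `|f x| ^+ N + be^-1 ^+ N * `|g x| ^+ N +
      ga^-1 ^+ N * `|v x| ^+ N))).
    apply: le_Rintegral => //; [exact: itgZ|exact: (itgD (itgD f1 g1) v1)|].
    move=> x _; rewrite -!exprMn.
    have pos (c y : R) : 0 < c -> 0 <= c^-1 * `|y| by move=> c0'; rewrite mulr_ge0// invr_ge0 ltW.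
    apply: le_trans (pt _ _ _ (pos _ _ al0) (pos _ _ be0) (pos _ _ ga0)).
    rewrite exprMn exprVn.
    rewrite le_eqVlt; apply/orP; left; apply/eqP; field.
    by rewrite !gt_eqF.
  rewrite RintegralD//; last exact: itgD.
  by rewrite RintegralD//; lra.
(* The norms may vanish; they are enlarged by 1 / (j + 1) before dividing, and j tends to
   infinity. *)
have hz (z : R) : z + harmonic j @[j --> \oo] --> z.
  by rewrite -[X in _ --> X]addr0; apply: cvgD; [exact: cvg_cst|exact: cvg_harmonic].
have c : 3 * ((Nq N%:R f + harmonic j) * (Nq N%:R g + harmonic j) ^+ n * (Nq N%:R v + harmonic j))
    @[j --> \oo] --> 3 * (Nq N%:R f * Nq N%:R g ^+ n * Nq N%:R v).
  apply: cvgMl_tmp; apply: cvgM => //; apply: cvgM => //.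
  apply: (@continuous_cvg _ _ _ \oo _ _ (fun x : R => x ^+ n)); last exact: hz.
  exact: exprn_continuous.
apply: (ler_cvg_to (cvg_cst _) c); apply: nearW => j.
have h0 : 0 < harmonic j :> R by exact: harmonic_gt0.
have nf := Nq_ge0 N%:R f; have ng := Nq_ge0 N%:R g; have nv := Nq_ge0 N%:R v.
by apply: key; lra.
Qed.

End NatPower.

End Lq.

(** * The weak problem *)

(** The variational theory needs a type of vectors, whereas the energy space is a set of functions
    depending on the noise; [vec] below turns such a set into an [lmodType]. *)
Record subspace (R : realType) (W : lmodType R) := Subspace {
  carrier : set W;
  carrier0 : carrier 0;
  carrierP : forall k u v, carrier u -> carrier v -> carrier (k *: u + v) }.

Definition mem_subspace (R : realType) (W : lmodType R) (M : subspace W) : {pred W} :=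
  [pred u | u \in carrier M].

Lemma mem_subspace_closed (R : realType) (W : lmodType R) (M : subspace W) :
  submod_closed (mem_subspace M).
Proof.
split=> [|k u v]; rewrite !unfold_in /= !inE; first exact: carrier0.
exact: carrierP.
Qed.

HB.instance Definition _ (R : realType) (W : lmodType R) (M : subspace W) :=
  GRing.isSubmodClosed.Build R W (mem_subspace M) (mem_subspace_closed M).

Record vec (R : realType) (W : lmodType R) (M : subspace W) := Vec {
  vecval : W;
  vecP : mem_subspace M vecval }.

HB.instance Definition _ (R : realType) (W : lmodType R) (M : subspace W) :=
  [isSub of vec M for @vecval R W M].
HB.instance Definition _ (R : realType) (W : lmodType R) (M : subspace W) :=
  [Choice of vec M by <:].
HB.instance Definition _ (R : realType) (W : lmodType R) (M : subspace W) :=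
  [SubChoice_isSubLmodule of vec M by <:].

Section VecTheory.
Variables (R : realType) (W : lmodType R) (M : subspace W).

Lemma vec_in (u : vec M) : carrier M (vecval u).
Proof. by have := vecP u; rewrite /mem_subspace /= inE. Qed.

Definition to_vec w (wM : carrier M w) : vec M.
Proof. by apply: (@Vec R W M w); rewrite /mem_subspace /= inE. Defined.

Lemma vecvalP (k : R) (u v : vec M) : vecval (k *: u + v) = k *: vecval u + vecval v.
Proof. by []. Qed.

Lemma vecval_sum n (c : 'I_n -> R) (e : 'I_n -> vec M) :
  vecval (\sum_j c j *: e j) = \sum_j c j *: vecval (e j).
Proof. by apply: (big_rec2 (fun (x : vec M) y => vecval x = y)) => // j x y _ <-. Qed.

End VecTheory.

Lemma cvgn0_lt (R : realType) (f : nat -> R) (eps : R) :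
  f @ \oo --> (0 : R) -> 0 < eps ->
  exists N, forall n, (N <= n)%N -> `|f n| < eps.
Proof.
move=> /cvgrPdist_lt/(_ eps) f0 /f0[N _ NP]; exists N => n /NP /=.
by rewrite sub0r normrN.
Qed.

(** * Consequences of a compact inclusion into a Lebesgue space *)

Section Embedding.
Context d (T : measurableType d) (R : realType) (mu : {measure set T -> \bar R}).
Variables (E : set (T -> R)) (nE : (T -> R) -> R).
Hypothesis Elin : forall (k : R) (u v : T -> R), E u -> E v -> E (k *: u + v).
Hypothesis E0 : E 0.
Hypothesis nEZ : forall (k : R) u, E u -> nE (k *: u) = `|k| * nE u.
Hypothesis nE_ge0 : forall u, 0 <= nE u.
Variable q : R.
Hypothesis q1 : 1 <= q.
Hypothesis incl : forall u, E u -> u \in Lfun mu q%:E.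
Hypothesis cpt : forall (phi : nat -> T -> R) (C : R),
    (forall n, E (phi n) /\ nE (phi n) <= C) ->
    exists (s : nat -> nat) (u : T -> R),
      [/\ {homo s : m n / (m < n)%N}, u \in Lfun mu q%:E &
          (fun n => Nq mu q (phi (s n) - u)) @ \oo --> (0 : R)].

Lemma LfunB (f g : T -> R) : f \in Lfun mu q%:E -> g \in Lfun mu q%:E -> f - g \in Lfun mu q%:E.
Proof.
move=> fq gq; have qe : (1 <= q%:E)%E by rewrite lee_fin.
by apply: (@Lfun_addr_closed _ _ _ mu _ qe).2 => //; exact: Lfun_oppr_closed.
Qed.

Lemma Nq_distC (f g : T -> R) : f \in Lfun mu q%:E -> g \in Lfun mu q%:E ->
  Nq mu q (f - g) = Nq mu q (g - f).
Proof.
move=> fq gq; rewrite -[RHS]mul1r -(normr1 R) -normrN -NqZ//; last exact: LfunB.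
by rewrite scaleN1r opprB.
Qed.

(** A compact inclusion is bounded: otherwise some vectors of the unit ball have norms n in L^q, and
    no subsequence of them converges. *)
Lemma embedding_bound : exists2 C, 0 <= C & forall u, E u -> Nq mu q u <= C * nE u.
Proof.
apply: contrapT => no.
have /choice[w wP] : forall n : nat, exists w, [/\ E w, nE w <= 1 & Nq mu q w = n%:R].
  move=> n; have [u Eu nu] : exists2 u, E u & n%:R * nE u < Nq mu q u.
    apply: contrapT => nu; apply: no; exists n%:R => // u Eu.
    by rewrite leNgt; apply/negP => h; apply: nu; exists u.
  have N0 : 0 < Nq mu q u by apply: le_lt_trans nu; rewrite mulr_ge0.
  have Ec (k : R) : E (k *: u) by rewrite -[k *: u]addr0; exact: Elin.
  exists ((n%:R / Nq mu q u) *: u); split; first exact: Ec.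
    rewrite nEZ// ger0_norm ?divr_ge0 ?Nq_ge0// mulrAC ler_pdivrMr// mul1r.
    exact: ltW.
  rewrite NqZ//; last exact: incl.
  by rewrite ger0_norm ?divr_ge0 ?Nq_ge0// divfK// gt_eqF.
have [|s [u [sh uq su]]] := @cpt w 1; first by move=> n; have [] := wP n.
have si n : (n <= s n)%N by elim: n => // n IH; apply: leq_ltn_trans IH (sh _ _ _).
have [N NP] := cvgn0_lt su ltr01.
pose M := maxn N (Num.truncn (Nq mu q u + 1)).+1.
have MN : (N <= M)%N by exact: leq_maxl.
have Mt : Nq mu q u + 1 < M%:R.
  have /andP[_ h] := truncn_itv (addr_ge0 (Nq_ge0 mu q u) ler01).
  by apply: lt_le_trans h _; rewrite ler_nat leq_maxr.
have [Ew _ nw] := wP (s M).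
have := NP _ MN; rewrite ger0_norm ?Nq_ge0// => d1.
have : Nq mu q (w (s M)) <= Nq mu q (w (s M) - u) + Nq mu q u.
  by rewrite -{1}(subrK u (w (s M))); apply: NqD => //; apply: LfunB => //; exact: incl.
rewrite nw => h; have : M%:R <= (s M)%:R :> R by rewrite ler_nat.
lra.
Qed.

(** The limit is known to lie in L^q only, not in [E]; hence the formulation by Cauchy sequences. *)
Lemma embedding_precompact (g : nat -> T -> R) C : (forall i, E (g i)) ->
  (forall i, nE (g i) <= C) ->
  exists2 s : nat -> nat, {homo s : m n / (m < n)%N} & vcauchy (Nq mu q) (g \o s).
Proof.
move=> Eg gC; have [|s [u [sh uq su]]] := @cpt g C; first by move=> n; split.
exists s => // eps eps0; have e2 : 0 < eps / 2 by rewrite divr_gt0.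
have [N NP] := cvgn0_lt su e2.
exists N => i j /NP + /NP; rewrite !ger0_norm ?Nq_ge0// => ui uj.
have gq m : g m \in Lfun mu q%:E by exact: incl.
have -> : (g \o s) i - (g \o s) j = (g (s i) - u) + (u - g (s j)).
  by rewrite addrA subrK.
apply: le_lt_trans (NqD _ _ _) _ => //; try exact: LfunB.
rewrite (Nq_distC uq)//; lra.
Qed.

End Embedding.

(** Let e be the square root of [del]. Either x is at most e y, or y is less than x / e and the
    hypothesis bounds x by a constant. *)
Lemma sublinear (R : realType) (q A0 del : R) : 2 <= q -> 0 <= A0 -> 0 < del ->
  exists K, forall x y, 0 <= x -> 0 <= y -> x `^ q <= A0 * y `^ (q - 1) ->
    x ^+ 2 <= del * y ^+ 2 + K.
Proof.
move=> q2 A00 d0; pose e := Num.sqrt del.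
have e0 : 0 < e by rewrite sqrtr_gt0.
have eE : e ^+ 2 = del by rewrite sqr_sqrtr// ltW.
exists ((A0 * e^-1 `^ (q - 1)) ^+ 2) => x y x0 y0 xy.
have [xe|xe] := leP x (e * y).
  have : x ^+ 2 <= (e * y) ^+ 2 by rewrite lerXn2r// nnegrE mulr_ge0// ltW.
  by rewrite exprMn eE => h; apply: le_trans h _; rewrite lerDl sqr_ge0.
have xp : 0 < x by apply: le_lt_trans xe; rewrite mulr_ge0// ltW.
have yx : y <= e^-1 * x by rewrite ler_pdivlMl// ltW.
have h : x <= A0 * e^-1 `^ (q - 1).
  have xq : 0 < x `^ (q - 1) by rewrite powR_gt0.
  rewrite -(ler_pM2r xq) -mulrA -powRM//; last by rewrite invr_ge0 ltW.
  rewrite mulr_powRB1//; last lra.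
  apply: le_trans xy _; rewrite ler_wpM2l// ge0_ler_powR// ?nnegrE//; first lra.
  by rewrite mulr_ge0// invr_ge0 ltW.
have : x ^+ 2 <= (A0 * e^-1 `^ (q - 1)) ^+ 2.
  by rewrite lerXn2r// nnegrE// mulr_ge0// powR_ge0.
move/le_trans; apply; rewrite lerDr mulr_ge0 ?sqr_ge0//; exact: ltW.
Qed.

(** * Weighted forms, equivalent norms and inequalities between powers *)

Section WeightedForm.
Context d (T : measurableType d) (R : realType) (mu : {measure set T -> \bar R}).
Variables (M : subspace (T -> R)) (th : T -> R).
Hypothesis M_meas : forall u, carrier M u -> measurable_fun setT u.
Hypothesis th_meas : measurable_fun setT th.
Hypothesis th_ge0 : forall x, 0 <= th x.
Hypothesis th_int : forall u, carrier M u -> itg mu (fun x => th x * u x ^+ 2).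

Definition wform (u v : vec M) : R := Rintegral mu setT (fun x => th x * vecval u x * vecval v x).

Lemma wform_itg (u v : vec M) : itg mu (fun x => th x * vecval u x * vecval v x).
Proof.
have mu_ := M_meas (vec_in u); have mv := M_meas (vec_in v).
apply: itg_le (itgD (th_int (vec_in u)) (th_int (vec_in v))).
  by apply: measurable_funM => //; exact: measurable_funM.
move=> x; rewrite -mulrA normrM (ger0_norm (th_ge0 x)) -mulrDr ler_wpM2l//.
move: (vecval u x) (vecval v x) => a b.
have h1 := sqr_ge0 (a - b); have h2 := sqr_ge0 (a + b); have h3 := sqr_ge0 a; have h4 := sqr_ge0 b.
by rewrite ler_norml; apply/andP; split; nra.
Qed.

Lemma wform_semi_inner : semi_inner wform.
Proof.
split=> [u v|t u u' v|u].
- by apply: eq_Rintegral => x _; ring.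
- rewrite /wform -RintegralZl//; last exact: wform_itg.
  rewrite -RintegralD//; [|exact: (itgZ _ (wform_itg _ _))|exact: wform_itg].
  apply: eq_Rintegral => x _; rewrite vecvalP.
  by rewrite -[(t *: vecval u + vecval u') x]/(t * vecval u x + vecval u' x); ring.
- by apply: Rintegral_ge0 => x _; rewrite -mulrA mulr_ge0// -expr2 sqr_ge0.
Qed.

Lemma wformE u : wform u u = Rintegral mu setT (fun x => th x * vecval u x ^+ 2).
Proof. by apply: eq_Rintegral => x _; ring. Qed.

End WeightedForm.

Lemma semi_innerD (R : realType) (V : lmodType R) (B B' : V -> V -> R) :
  semi_inner B -> semi_inner B' -> semi_inner (fun u v => B u v + B' u v).
Proof.
move=> sB sB'; split=> [u v|t u u' v|u].
- by rewrite (sipC sB) (sipC sB').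
- by rewrite (sipl sB) (sipl sB'); ring.
- by rewrite addr_ge0// ?(sip_ge0 sB) ?(sip_ge0 sB').
Qed.

Lemma semi_inner_le (R : realType) (V : lmodType R) (D : V -> V -> R) (n : V -> R) (K : R) :
  semi_inner D -> 0 <= K -> (forall u, 0 <= n u) -> (forall u, D u u <= K * n u ^+ 2) ->
  forall u v, `|D u v| <= K * n u * n v.
Proof.
move=> sD K0 n0 DK u v; apply: le_trans (cauchy_schwarz sD u v) _.
have h w : snorm D w <= Num.sqrt K * n w.
  rewrite /snorm -[n w]ger0_norm// -sqrtr_sqr -sqrtrM// ler_sqrt//.
  by rewrite mulr_ge0 ?sqr_ge0.
have -> : K * n u * n v = (Num.sqrt K * n u) * (Num.sqrt K * n v).
  by rewrite -{1}[K]sqr_sqrtr//; ring.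
by apply: ler_pM; rewrite ?snorm_ge0.
Qed.

Lemma complete_equiv (R : realType) (V : lmodType R) (B B' : V -> V -> R) (C : R) :
  semi_inner B -> semi_inner B' ->
  (forall u, B u u <= B' u u) -> (forall u, B' u u <= C ^+ 2 * B u u) -> 0 <= C ->
  complete B -> complete B'.
Proof.
move=> sB sB' le1 le2 C0 cB g gc.
have n1 u : snorm B u <= snorm B' u by rewrite ler_sqrt// (sip_ge0 sB').
have n2 u : snorm B' u <= C * snorm B u.
  rewrite /snorm -[C]ger0_norm// -sqrtr_sqr -sqrtrM ?sqr_ge0// ler_sqrt//.
  by rewrite mulr_ge0 ?sqr_ge0// (sip_ge0 sB).
have [|l gl] := cB g.
  by move=> eps /gc[N NP]; exists N => i j Ni Nj; apply: le_lt_trans (n1 _) (NP _ _ Ni Nj).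
exists l; rewrite /vcvg in gl *.
have c : C * snorm B (g t - l) @[t --> \oo] --> (0 : R).
  by rewrite -(mulr0 C); exact: cvgMl_tmp.
by apply: (cvg_dist_le c); apply: nearW => t; rewrite subr0 ger0_norm ?snorm_ge0.
Qed.

(** Even powers reduce this to nonnegative reals. There, by induction on the exponent, the gap is b
    times the previous gap plus a nonnegative multiple of a square. *)
Lemma young_pow (R : realType) (m : nat) (x y : R) :
  m.*2.+2%:R * (x ^+ m.*2.+1 * y) <= y ^+ m.*2.+2 + m.*2.+1%:R * x ^+ m.*2.+2.
Proof.
set n := m.*2.+1.
have evenp (z : R) : z ^+ n.+1 = `|z| ^+ n.+1.
  by rewrite /n -doubleS -mul2n !exprM real_normK// num_real.
suff pos (a b : R) : 0 <= a -> 0 <= b -> n.+1%:R * (a ^+ n * b) <= b ^+ n.+1 + n%:R * a ^+ n.+1.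
  rewrite (evenp x) (evenp y); apply: le_trans (pos _ _ (normr_ge0 x) (normr_ge0 y)).
  by rewrite ler_wpM2l// -normrX -normrM ler_norm.
move=> a0 b0; elim: n {evenp} => [|k IH].
  by rewrite !expr0 mul0r addr0 !mul1r expr1.
have h : b ^+ k.+2 + k.+1%:R * a ^+ k.+2 - k.+2%:R * (a ^+ k.+1 * b) =
  b * (b ^+ k.+1 + k%:R * a ^+ k.+1 - k.+1%:R * (a ^+ k * b)) + k.+1%:R * a ^+ k * (a - b) ^+ 2.
  by rewrite -!natr1 !exprS; ring.
rewrite -subr_ge0 h addr_ge0//; first by rewrite mulr_ge0// subr_ge0.
by rewrite mulr_ge0 ?sqr_ge0// mulr_ge0// exprn_ge0.
Qed.

Lemma pow_diff_le (R : realType) (n : nat) (x y : R) :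
  `|x ^+ n.+1 - y ^+ n.+1| <= n.+1%:R * (`|x - y| * (`|x| + `|y|) ^+ n).
Proof.
rewrite subrXX normrM mulrCA ler_wpM2l//.
apply: le_trans (ler_norm_sum _ _ _) _.
rewrite -[n.+1 in leRHS]card_ord -sum1_card natr_sum mulr_suml ler_sum// => i _.
rewrite mul1r normrM !normrX.
have s0 : 0 <= `|x| + `|y| by rewrite addr_ge0.
have -> : (`|x| + `|y|) ^+ n = (`|x| + `|y|) ^+ (n.+1.-1 - i) * (`|x| + `|y|) ^+ i.
  by rewrite -exprD subnK// -ltnS.
by apply: ler_pM; rewrite ?exprn_ge0// lerXn2r// ?nnegrE ?lerDl ?lerDr.
Qed.

(** * The abstract theorem applied to the energy space *)

Section WeakSolutions.
Variables (R : realType) (S : ptopologicalType).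
Variables (mu : {measure set (borel S) -> \bar R}).
Variables (H : (S -> R) -> (S -> R) -> Prop) (c : R).
Variables (E : set (S -> R)) (dot : (S -> R) -> (S -> R) -> R).
Hypothesis HE : energy_space mu H E dot c.
Hypothesis Hq : forall q : R, 1 < q ->
  compactly_included E (Leb mu q%:E) (norm_of dot) (Lqnorm mu q).
Hypothesis E0 : E 0.
Hypothesis Einf : forall n, exists e : 'I_n -> S -> R, (forall j, E (e j)) /\
  forall x : 'rV[R]_n, x != 0 -> ~ eq_mu mu (\sum_j x ord0 j *: e j) (cst 0).

Definition energy : subspace (borel S -> R) :=
  @Subspace R (borel S -> R) E E0 (energy_linear HE).

Local Notation V := (vec energy).

Lemma energy_Lfun q (u : S -> R) : 1 < q -> E u -> (u : borel S -> R) \in Lfun mu q%:E.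
Proof. by move=> /Hq[+ _]; exact. Qed.

Lemma energy_measurable (u : S -> R) : E u -> measurable_fun setT (u : borel S -> R).
Proof. by move=> /(energy_Lfun (ltr1n R 2))/Lfun_measurable. Qed.

Definition edot (u v : V) : R := dot (vecval u) (vecval v).

Lemma edot_semi_inner : semi_inner edot.
Proof.
split=> [u v|t u u' v|u].
- exact: (energy_dotC HE (vec_in u) (vec_in v)).
- exact: (energy_dotl HE t (vec_in u) (vec_in u') (vec_in v)).
- exact: (energy_ge0 HE (vec_in u)).
Qed.

Lemma edot_complete : complete edot.
Proof.
move=> g gc.
have [|l El gl] := energy_complete HE (phi := fun n => vecval (g n)) (fun n => vec_in (g n)).
  by move=> eps /gc[N NP]; exists N => i j Ni Nj; exact: NP.
by exists (@to_vec _ _ energy l El).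
Qed.

Lemma norm_ofZ (k : R) (u : S -> R) : E u -> norm_of dot (k *: u) = `|k| * norm_of dot u.
Proof. by move=> Eu; exact: (snormZ edot_semi_inner k (@to_vec _ _ energy u Eu)). Qed.

Lemma energy_bound q : 1 < q ->
  exists2 C, 0 <= C & forall u : V, Nq mu q (vecval u) <= C * snorm edot u.
Proof.
move=> q1; have q1' := ltW q1; have [inc cpt] := Hq q1.
have [C C0 CP] := @embedding_bound _ (borel S) R mu E (norm_of dot) (energy_linear HE) E0
  norm_ofZ (fun u => sqrtr_ge0 _) q q1' (fun u => @energy_Lfun q u q1) cpt.
by exists C => // u; exact: CP (vec_in u).
Qed.

Lemma energy_precompact q (g : nat -> V) C : 1 < q -> (forall i, snorm edot (g i) <= C) ->
  exists2 s : nat -> nat, {homo s : m n / (m < n)%N} &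
    vcauchy (fun u : V => Nq mu q (vecval u)) (g \o s).
Proof.
move=> q1 gC; have q1' := ltW q1; have [inc cpt] := Hq q1.
have [s sh sc] := @embedding_precompact _ (borel S) R mu E (norm_of dot) q q1'
   (fun u => @energy_Lfun q u q1) cpt (fun i => vecval (g i)) C (fun i => vec_in (g i)) gC.
by exists s.
Qed.

Variables (m : nat) (m_gt0 : (0 < m)%N) (p : \bar R) (p1 : (1 < p)%E).
Variables (a : S -> R) (ap : Leb mu p a).
Local Notation N := (m.*2.+2).

Definition pot : borel S -> R := fun x => a x - c.
Definition pot_pos : borel S -> R := fun x => (`|pot x| + pot x) / 2.
Definition pot_neg : borel S -> R := fun x => (`|pot x| - pot x) / 2.

Lemma potential_measurable : measurable_fun setT (a : borel S -> R).
Proof. exact: Lfun_measurable ap. Qed.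

Lemma pot_measurable : measurable_fun setT pot.
Proof. by apply: measurable_funB => //; exact: potential_measurable. Qed.

Lemma pot_pos_measurable : measurable_fun setT pot_pos.
Proof.
apply: measurable_funM => //; apply: measurable_funD; last exact: pot_measurable.
exact: (measurableT_comp _ pot_measurable).
Qed.

Lemma pot_neg_measurable : measurable_fun setT pot_neg.
Proof.
apply: measurable_funM => //; apply: measurable_funB; last exact: pot_measurable.
exact: (measurableT_comp _ pot_measurable).
Qed.

Lemma pot_pos_ge0 x : 0 <= pot_pos x.
Proof.
rewrite /pot_pos divr_ge0//; have := ler_norm (- pot x); rewrite normrN; lra.
Qed.

Lemma pot_neg_ge0 x : 0 <= pot_neg x.
Proof. by rewrite /pot_neg divr_ge0//; have := ler_norm (pot x); lra. Qed.

Lemma potB x : pot_pos x - pot_neg x = pot x.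
Proof. by rewrite /pot_pos /pot_neg; field. Qed.

Lemma pot_bound : exists q A, [/\ 2 <= q, 0 <= A &
  forall th : borel S -> R, measurable_fun setT th ->
    (forall x, 0 <= th x <= `|pot x|) -> forall u : S -> R, E u ->
    itg mu (fun x => th x * u x ^+ 2) /\
    Rintegral mu setT (fun x => th x * u x ^+ 2) <=
      A * (Nq mu q u ^+ 2 + Nq mu 2 u ^+ 2)].
Proof.
have [q [A [q2 A0 aP]]] := potential_bound p1 ap.
exists q, (A + `|c|); split=> //; first by rewrite addr_ge0.
move=> th mth thP u Eu.
have q1 : 1 < q by lra.
have [ai aI] := aP u (energy_Lfun q1 Eu).
have u2 := energy_Lfun (ltr1n R 2) Eu.
have [ui uI] : itg mu (fun x : borel S => u x ^+ 2) /\
    Rintegral mu setT (fun x : borel S => u x ^+ 2) = Nq mu 2 u ^+ 2.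
  have := @Lfun_natpow _ _ _ mu 0 u u2.
  rewrite (_ : (fun x => `|u x| ^+ 2) = (fun x => u x ^+ 2))//.
  by apply: funext => x; rewrite real_normK// num_real.
have ci := itgZ `|c| ui.
have le x : th x * u x ^+ 2 <= `|a x| * u x ^+ 2 + `|c| * u x ^+ 2.
  have /andP[_ th2] := thP x; rewrite -mulrDl ler_wpM2r ?sqr_ge0//.
  by apply: le_trans th2 _; rewrite /pot; apply: le_trans (ler_normB _ _) _.
have ti : itg mu (fun x => th x * u x ^+ 2).
  apply: itg_le (itgD ai ci).
    by apply: measurable_funM => //; apply: measurable_funX; exact: energy_measurable.
  move=> x; rewrite ger0_norm// mulr_ge0 ?sqr_ge0//.
  by have /andP[] := thP x.
split=> //.
apply: le_trans (le_Rintegral _ ti (itgD ai ci) _) _ => //.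
rewrite RintegralD// RintegralZl// uI.
have h1 := sqr_ge0 (Nq mu q u); have h2 := sqr_ge0 (Nq mu 2 u); have h3 := normr_ge0 c.
by nra.
Qed.

Lemma pot_pos_le x : 0 <= pot_pos x <= `|pot x|.
Proof. by rewrite pot_pos_ge0 /pot_pos ler_pdivrMr//; have := ler_norm (pot x); lra. Qed.

Lemma pot_neg_le x : 0 <= pot_neg x <= `|pot x|.
Proof.
rewrite pot_neg_ge0 /pot_neg ler_pdivrMr//.
by have := ler_norm (- pot x); rewrite normrN; lra.
Qed.

Definition kform (u v : V) : R :=
  Rintegral mu setT (fun x => vecval u x ^+ m.*2.+1 * vecval v x).

Lemma NR_gt1 : 1 < N%:R :> R. Proof. by rewrite ltr1n. Qed.

Lemma even_pow_norm (z : R) : `|z| ^+ N = z ^+ N.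
Proof. by rewrite -doubleS -mul2n !exprM real_normK// num_real. Qed.

Lemma kform_itg (u v : V) : itg mu (fun x => vecval u x ^+ m.*2.+1 * vecval v x).
Proof.
have uN := energy_Lfun NR_gt1 (vec_in u); have vN := energy_Lfun NR_gt1 (vec_in v).
have [i _] := trilinear_itg uN uN vN.
apply: itg_le i.
  apply: measurable_funM; last exact: energy_measurable (vec_in v).
  by apply: measurable_funX; exact: energy_measurable (vec_in u).
by move=> x; rewrite normrM normrX exprS.
Qed.

Lemma kform_mass u : kform u u = Nq mu N%:R (vecval u) ^+ N.
Proof.
have [_ <-] := Lfun_natpow (energy_Lfun NR_gt1 (vec_in u)).
by apply: eq_Rintegral => x _; rewrite even_pow_norm -exprSr.
Qed.

(** The L^N norm controls the nonlinearity, the L^q norm the potential [a], and the L^2 norm the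
    constant [c]. *)
Definition enorm q (u : V) := Nq mu N%:R (vecval u) + Nq mu q (vecval u) + Nq mu 2 (vecval u).

Lemma kform_lip q u u' w :
  `|kform u w - kform u' w| <= 3 * m.*2.+1%:R *
    (enorm q u + enorm q u') ^+ m.*2 * enorm q (u - u') * enorm q w.
Proof.
have uN := energy_Lfun NR_gt1 (vec_in u); have uN' := energy_Lfun NR_gt1 (vec_in u').
have wN := energy_Lfun NR_gt1 (vec_in w).
have dN := energy_Lfun NR_gt1 (vec_in (u - u')).
have nN (v : V) : Nq mu N%:R (vecval v) <= enorm q v.
  by rewrite /enorm -addrA lerDl addr_ge0// Nq_ge0.
have n1 : 1 <= N%:R :> R by exact: ltW NR_gt1.
(* The difference of the powers is pointwise at most N - 1 times |u - u'| g^(N-2), to which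
   [trilinear_itg] applies. *)
pose g : borel S -> R := fun x => `|vecval u x| + `|vecval u' x|.
have absN (v : V) : (fun x => `|vecval v x|) \in Lfun mu N%:R%:E /\
    Nq mu N%:R (fun x => `|vecval v x|) = Nq mu N%:R (vecval v).
  have vN := energy_Lfun NR_gt1 (vec_in v).
  have := @Lfun_powR _ _ _ mu 1 N%:R (vecval v) ltr01 n1.
  rewrite mulr1 => /(_ n1 vN); rewrite powRr1 ?Nq_ge0//.
  rewrite (_ : (fun x => _ `^ 1) = (fun x => `|vecval v x|))//.
  by apply: funext => x; rewrite powRr1.
have [au nu] := absN u; have [au' nu'] := absN u'.
have qe : (1 <= N%:R%:E :> \bar R)%E by rewrite lee_fin.
have gN : g \in Lfun mu N%:R%:E by exact: (@Lfun_addr_closed _ _ _ mu _ qe).2.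
have gle : Nq mu N%:R g <= enorm q u + enorm q u'.
  by apply: le_trans (NqD n1 au au') _; rewrite nu nu' lerD.
have [ti tI] := trilinear_itg dN gN wN.
have di := kform_itg u w; have di' := kform_itg u' w.
rewrite /kform -RintegralB//.
apply: le_trans (le_normr_Rintegral _ (integrableB _ di di')) _ => //.
have tiM := itgZ m.*2.+1%:R ti.
apply: (@le_trans _ _ (Rintegral mu setT (fun x => m.*2.+1%:R *
    (`|vecval (u - u') x| * `|g x| ^+ m.*2 * `|vecval w x|)))).
  apply: le_Rintegral => //; first exact: (integrable_norm (integrableB _ di di')).
  move=> x _; rewrite -mulrBl normrM !mulrA ler_wpM2r// -mulrA.
  by rewrite [`|g x|]ger0_norm ?addr_ge0//; exact: pow_diff_le.
rewrite RintegralZl// -!mulrA mulrCA ler_wpM2l//; apply: le_trans tI _.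
rewrite ler_wpM2l// -mulrA mulrCA ler_pM ?mulr_ge0 ?exprn_ge0 ?Nq_ge0//.
  by rewrite lerXn2r// nnegrE ?Nq_ge0// (le_trans (Nq_ge0 mu N%:R g)).
by apply: ler_pM; rewrite ?Nq_ge0.
Qed.

Lemma vcauchy_sub (n : V -> R) (g : nat -> V) (s : nat -> nat) :
  {homo s : i j / (i < j)%N} -> vcauchy n g -> vcauchy n (g \o s).
Proof.
move=> sh gc eps /gc[M MP]; exists M => i j Mi Mj.
have si k : (k <= s k)%N by elim: k => // k IH; apply: leq_ltn_trans IH (sh _ _ _).
by apply: MP; apply: leq_trans (si _).
Qed.

Lemma enorm_precompact q (g : nat -> V) C : 2 <= q -> (forall i, snorm edot (g i) <= C) ->
  exists2 s : nat -> nat, {homo s : i j / (i < j)%N} & vcauchy (enorm q) (g \o s).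
Proof.
move=> q2 gC; have q1 : 1 < q by lra.
have [s1 h1 c1] := energy_precompact NR_gt1 gC.
have [s2 h2 c2] := energy_precompact q1 (fun i => gC (s1 i)).
have [s3 h3 c3] := energy_precompact (ltr1n R 2) (fun i => gC (s1 (s2 i))).
exists (s1 \o s2 \o s3).
  by move=> i j ij; apply: h1; apply: h2; exact: h3.
move=> eps eps0; have e3 : 0 < eps / 3 by rewrite divr_gt0.
have [N1 P1] := vcauchy_sub h3 (vcauchy_sub h2 c1) e3.
have [N2 P2] := vcauchy_sub h3 c2 e3.
have [N3 P3] := c3 _ e3.
exists (maxn N1 (maxn N2 N3)) => i j; rewrite !geq_max => /and3P[i1 i2 i3] /and3P[j1 j2 j3].
have := P1 _ _ i1 j1; have := P2 _ _ i2 j2; have := P3 _ _ i3 j3; rewrite /enorm /=.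
by move=> x3 x2 x1; lra.
Qed.

(* Splitting the potential by sign makes Bform positive definite without any
   lower bound on the quadratic form of the equation. *)
Definition Bform (u v : V) := edot u v + wform mu pot_pos u v.
Definition Dform : V -> V -> R := wform mu pot_neg.

Lemma Bform_DformE (u v : V) :
  Bform u v - Dform u v = edot u v + Rintegral mu setT (fun x => pot x * vecval u x * vecval v x).
Proof.
have [q [A [q2 A0 potP]]] := pot_bound.
rewrite /Bform -addrA; congr (_ + _); rewrite /Dform /wform -RintegralB//.
- by apply: eq_Rintegral => x _; rewrite -potB; ring.
- apply: wform_itg; [exact: energy_measurable|exact: pot_pos_measurable|exact: pot_pos_ge0|].
  by move=> w /(potP _ pot_pos_measurable pot_pos_le)[].
- apply: wform_itg; [exact: energy_measurable|exact: pot_neg_measurable|exact: pot_neg_ge0|].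
  by move=> w /(potP _ pot_neg_measurable pot_neg_le)[].
Qed.

Lemma weak_high_energy beta : exists2 w : V,
  forall v : V,
    edot w v + Rintegral mu setT (fun x => pot x * vecval w x * vecval v x) = kform w v &
  beta <= kform w w ^+ m.
Proof.
have [q [A [q2 A0 potP]]] := pot_bound.
have q1 : 1 < q by lra.
have s0 := edot_semi_inner.
have sP : semi_inner (wform mu pot_pos : V -> V -> R).
  apply: wform_semi_inner; [exact: energy_measurable|exact: pot_pos_measurable|exact: pot_pos_ge0|].
  by move=> w /(potP _ pot_pos_measurable pot_pos_le)[].
have sD : semi_inner Dform.
  apply: wform_semi_inner; [exact: energy_measurable|exact: pot_neg_measurable|exact: pot_neg_ge0|].
  by move=> w /(potP _ pot_neg_measurable pot_neg_le)[].
have sB : semi_inner Bform by exact: semi_innerD.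
have Ple (u : V) : wform mu pot_pos u u <= A * (Nq mu q (vecval u) ^+ 2 + Nq mu 2 (vecval u) ^+ 2).
  by rewrite wformE; exact: (potP _ pot_pos_measurable pot_pos_le _ (vec_in u)).2.
have Dle (u : V) : Dform u u <= A * (Nq mu q (vecval u) ^+ 2 + Nq mu 2 (vecval u) ^+ 2).
  by rewrite /Dform wformE; exact: (potP _ pot_neg_measurable pot_neg_le _ (vec_in u)).2.
have [CN CN0 CNP] := energy_bound NR_gt1.
have [Cq Cq0 CqP] := energy_bound q1.
have [C2 C20 C2P] := energy_bound (ltr1n R 2).
have edotB u : edot u u <= Bform u u by rewrite lerDl (sip_ge0 sP).
have snormB u : snorm edot u <= snorm Bform u by rewrite ler_sqrt// (sip_ge0 sB).
(* [Bform] is bounded by [K] times the energy; as [K] is at least 1, also by the square that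
   [complete_equiv] asks for. *)
pose K := 1 + A * (Cq ^+ 2 + C2 ^+ 2).
have K0 : 0 <= K by rewrite addr_ge0// mulr_ge0// addr_ge0 ?sqr_ge0.
have Ble u : Bform u u <= K ^+ 2 * edot u u.
  have e0 := sip_ge0 s0 u.
  have K1 : K <= K ^+ 2 by rewrite expr2 ler_peMr// lerDl mulr_ge0// addr_ge0 ?sqr_ge0.
  apply: (@le_trans _ _ (K * edot u u)); last by rewrite ler_wpM2r.
  rewrite /Bform /K mulrDl mul1r lerD2l; apply: le_trans (Ple u) _.
  rewrite -mulrA ler_wpM2l// -(snorm_sqr s0) mulrDl -!exprMn.
  by rewrite lerD// lerXn2r ?nnegrE ?Nq_ge0 ?mulr_ge0 ?snorm_ge0.
have cB : complete Bform by exact: complete_equiv s0 sB edotB Ble K0 edot_complete.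
have enorm_ge0 (u : V) : 0 <= enorm q u by rewrite !addr_ge0 ?Nq_ge0.
have Den u : Dform u u <= A * enorm q u ^+ 2.
  apply: le_trans (Dle u) _; rewrite ler_wpM2l// /enorm.
  have n1 := Nq_ge0 mu N%:R (vecval u); have n2 := Nq_ge0 mu q (vecval u).
  have n3 := Nq_ge0 mu 2 (vecval u); move: n1 n2 n3.
  move: (Nq _ _ _) (Nq _ q _) (Nq _ 2 _) => x y z x0 y0 z0.
  by nra.
have [w wE wb] : exists2 w, forall v, Bform w v - Dform w v = kform w v & beta <= kform w w ^+ m.
  apply: (@high_energy_solution R V Bform Dform kform (enorm q) m sB sD cB
      (CN + Cq + C2) A (3 * m.*2.+1%:R)) => //.
  - by rewrite !addr_ge0.
  - move=> u; apply: (@le_trans _ _ ((CN + Cq + C2) * snorm edot u)).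
      by rewrite !mulrDl !lerD.
    by rewrite ler_wpM2l// !addr_ge0.
  - exact: semi_inner_le.
  - move=> u t v v'; rewrite /kform -RintegralZl//; last exact: kform_itg.
    rewrite -RintegralD//; [|exact: (itgZ _ (kform_itg _ _))|exact: kform_itg].
    apply: eq_Rintegral => x _; rewrite vecvalP.
    by rewrite -[(t *: vecval v + vecval v') x]/(t * vecval v x + vecval v' x); ring.
  - move=> t u v; rewrite /kform -RintegralZl//; last exact: kform_itg.
    apply: eq_Rintegral => x _.
    have -> : vecval (t *: u) x = t * vecval u x by [].
    by rewrite exprMn mulrA.
  - exact: kform_lip.
  - move=> u v; rewrite /kform -!RintegralZl//; try exact: kform_itg.
    have iv := kform_itg v v; have iu := itgZ m.*2.+1%:R (kform_itg u u).
    rewrite -RintegralD//; apply: le_Rintegral => //.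
    + exact: itgZ (kform_itg u v).
    + exact: itgD iv iu.
    + by move=> x _; rewrite -!exprSr; exact: young_pow.
  - move=> g C gC; apply: (@enorm_precompact q g C) => // i.
    exact: le_trans (snormB _) (gC i).
  (* Coercivity: a bounded mass bounds the L^N norm, so by [interpolation] and [sublinear] the form
     [Dform] is at most half of the energy plus a constant. *)
  - move=> Q0 J0.
    pose r := N%:R / (N%:R - 1) * (q - 1) : R.
    have N2 : 2 <= N%:R :> R by rewrite ler_nat.
    have r1 : 1 < r.
      rewrite /r -[ltLHS]mulr1 -[ltLHS]mulr1 mulr1 mulrAC ltr_pdivlMr ?mul1r; last lra.
      by nra.
    have [Cr Cr0 CrP] := energy_bound r1.
    have r2 : 1 < N%:R / (N%:R - 1) * (2 - 1) :> R.
      by rewrite [2 - 1](_ : _ = 1) ?mulr1 ?ltr_pdivlMr; lra.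
    have [Cs Cs0 CsP] := energy_bound r2.
    (* A bound for the L^N norm, which is at most 1 or at most its N-th power, the mass. *)
    pose j0 := 1 + `|J0|.
    have j00 : 0 <= j0 by rewrite addr_ge0.
    (* Chosen so that [A * (2 * del)] is at most 1/2. *)
    pose del := (4 * (A + 1))^-1.
    have del0 : 0 < del by rewrite invr_gt0 mulr_gt0//; lra.
    have Ar0 : 0 <= j0 * Cr `^ (q - 1) by rewrite mulr_ge0// powR_ge0.
    have As0 : 0 <= j0 * Cs `^ (2 - 1) by rewrite mulr_ge0// powR_ge0.
    have [Kq KqP] := sublinear q2 Ar0 del0.
    have [K2 K2P] := sublinear (lexx 2) As0 del0.
    exists (Num.sqrt (K ^+ 2 * (2 * (Q0 + A * (Kq + K2))))) => u uQ uJ.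
    have uN := energy_Lfun NR_gt1 (vec_in u).
    have Nj : Nq mu N%:R (vecval u) <= j0.
      rewrite /j0; have n0 := Nq_ge0 mu N%:R (vecval u).
      have [n1|n1] := leP (Nq mu N%:R (vecval u)) 1; first by have := normr_ge0 J0; lra.
      have : Nq mu N%:R (vecval u) <= Nq mu N%:R (vecval u) ^+ N.
        by rewrite exprS ler_peMr// exprn_ege1// ltW.
      rewrite -kform_mass; have := ler_norm J0; lra.
    have e0 := snorm_ge0 edot u.
    have hq : Nq mu q (vecval u) ^+ 2 <= del * snorm edot u ^+ 2 + Kq.
      apply: KqP => //; first exact: Nq_ge0.
      have q1' := energy_Lfun q1 (vec_in u).
      apply: le_trans (interpolation N2 q2 uN q1' (energy_Lfun r1 (vec_in u))) _.
      rewrite -(mulrA j0); apply: ler_pM => //; [exact: Nq_ge0|exact: powR_ge0|].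
      rewrite -powRM//; apply: ge0_ler_powR; [lra| | |exact: CrP]; rewrite nnegrE ?Nq_ge0//.
      by rewrite mulr_ge0.
    have h2 : Nq mu 2 (vecval u) ^+ 2 <= del * snorm edot u ^+ 2 + K2.
      apply: K2P => //; first exact: Nq_ge0.
      have q1' := energy_Lfun (ltr1n R 2) (vec_in u).
      apply: le_trans (interpolation N2 (lexx 2) uN q1' (energy_Lfun r2 (vec_in u))) _.
      rewrite -(mulrA j0); apply: ler_pM => //; [exact: Nq_ge0|exact: powR_ge0|].
      rewrite -powRM//; apply: ge0_ler_powR; [lra| | |exact: CsP]; rewrite nnegrE ?Nq_ge0//.
      by rewrite mulr_ge0.
    have key : edot u u <= 2 * (Q0 + A * (Kq + K2)).
      have P0 := sip_ge0 sP u.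
      have := Dle u => D1.
      have D2 : A * (Nq mu q (vecval u) ^+ 2 + Nq mu 2 (vecval u) ^+ 2) <=
          A * (2 * del * edot u u + (Kq + K2)).
        rewrite ler_wpM2l//; move: hq h2; rewrite (snorm_sqr s0); lra.
      have D3 : A * (2 * del * edot u u) <= edot u u / 2.
        have ee := sip_ge0 s0 u.
        rewrite mulrA mulrC ler_wpM2l// /del.
        rewrite mulrA invfM mulrA ler_pdivrMr; last by lra.
        by lra.
      move: uQ; rewrite /Bform mulrDr in D2 *; lra.
    rewrite /snorm ler_wsqrtr//; apply: le_trans (Ble u) _.
    by rewrite ler_wpM2l// sqr_ge0.
  - move=> n; have [e [Ee eP]] := Einf n.
    exists (fun j => @to_vec _ _ energy (e j) (Ee j)) => x x0.
    rewrite kform_mass exprn_gt0// lt_def Nq_ge0 andbT; apply/eqP => n0.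
    apply: (eP x x0).
    set w := \sum_j x ord0 j *: _ in n0.
    have wE : vecval w = \sum_j x ord0 j *: e j by rewrite /w vecval_sum.
    have qe : (1 <= N%:R%:E :> \bar R)%E by rewrite lee_fin ltW// NR_gt1.
    rewrite -wE /eq_mu.
    exact: (fine_Lnormr_eq0 (f := Lfun_Sub qe (energy_Lfun NR_gt1 (vec_in w))) n0).
exists w => // v; rewrite -wE Bform_DformE.
by [].
Qed.

End WeakSolutions.

(** * Independent families in the domain of the operator *)

Lemma smooth_continuous (R : realType) (S : ptopologicalType) (g : closed_surface R S)
  (f : S -> R) : smooth g f -> continuous f.
Proof.
move=> fs x; have [ax dx] := atlas_cover g x.
set c := chart_at g x in ax dx.
have [odom _ paramK coordc _] := atlas_chart ax.
have fc : {for Defs.coord c x, continuous (f \o param c)}.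
  by apply: (fs c ax 0%N); exists x.
have comp : {for x, continuous ((f \o param c) \o Defs.coord c)}.
  by apply: continuous_comp => //; exact: coordc.
have e : \forall y \near x, ((f \o param c) \o Defs.coord c) y = f y.
  by apply: filterS (open_nbhs_nbhs (conj odom dx)) => y dy /=; rewrite paramK.
have fx : f (param c (Defs.coord c x)) = f x by rewrite paramK.
move: comp => /cvgrPdist_lt comp; apply/cvgrPdist_lt => eps /comp.
by rewrite /= fx; apply: filterS2 e => y /= ->.
Qed.

Lemma borel_measurable (R : realType) (S : ptopologicalType) (f : S -> R) :
  continuous f -> measurable_fun setT (f : borel S -> R).
Proof.
move=> fc; apply: (measurability _ (RGenOInfty.measurableE R)).
move=> /= _ [_ [a ->]] <-; rewrite setTI; apply: sub_sigma_algebra.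
by have /continuousP := fc; apply; exact: interval_open.
Qed.

Section Basis.
Variables (R : realType) (S : ptopologicalType) (g : closed_surface R S).
Variable mu : {measure set (borel S) -> \bar R}.
Variables (e : nat -> S -> R) (lam : nat -> R) (e_basis : eigenbasis g mu e lam).

(** If the integral of the square were infinite, its real value would be the default 0, against the
    normalisation to 1. *)
Lemma basis_L2 n : L2 mu (e n).
Proof.
have [es _ eo _] := e_basis.
have me := borel_measurable (smooth_continuous (es n)).
apply: LfunP_powR => //; first by rewrite ler1n.
apply/integrableP; split.
  by apply/measurable_EFinP; exact: measurable_powR_norm.
have := eo n n; rewrite eqxx /L2dot /Rintegral.
have -> : (\int[mu]_x (e n x * e n x)%:E = \int[mu]_x `|(EFin \o (fun x => `|e n x| `^ 2)%R) x|)%E.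
  by apply: eq_integral => x _ /=; rewrite powR2_norm ger0_norm ?sqr_ge0.
case: (integral _ _ _) => [r| |]//=; first by rewrite ltry.
- by move/eqP; rewrite eq_sym oner_eq0.
Qed.

Lemma L2dot_le (u v : S -> R) : L2 mu u -> L2 mu v ->
  itg mu (fun x : borel S => u x * v x) /\ `|L2dot mu u v| <= L2norm mu u * L2norm mu v.
Proof.
move=> u2 v2; have h : 2^-1 + 2^-1 = 1 :> R by field.
have [i le] := hoelder_itg (ltr1n R 2) (ltr1n R 2) h u2 v2.
split=> //; apply: le_trans le; exact: le_normr_Rintegral.
Qed.

Lemma basis_norm n : L2norm mu (e n) = 1.
Proof.
have [_ _ eo _] := e_basis.
have := Nq_powR (ler1n R 2) (basis_L2 n).
have -> : Rintegral mu setT (fun x : borel S => `|e n x| `^ 2) = L2dot mu (e n) (e n).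
  by apply: eq_Rintegral => x _; rewrite powR2_norm.
rewrite eo eqxx powR_mulrn ?Nq_ge0// => /eqP.
by rewrite sqrp_eq1 ?Nq_ge0// => /eqP.
Qed.

(** Elements of [D] within 1 / (n + 1) of the first n basis vectors are independent: their products
    with these vectors form a diagonally dominant matrix. *)
Lemma dense_independent (D : set (S -> R)) n : dense_in D (L2 mu) (L2norm mu) ->
  exists f : 'I_n -> S -> R, (forall j, D (f j)) /\
  forall x : 'rV[R]_n, x != 0 -> ~ eq_mu mu (\sum_j x ord0 j *: f j) (cst 0).
Proof.
move=> [DL2 Dd]; have [_ _ eo _] := e_basis.
have eps0 : 0 < n.+1%:R^-1 :> R by rewrite invr_gt0.
have /choice[f fP] : forall j : 'I_n, exists f, D f /\ L2norm mu (f - e j) < n.+1%:R^-1.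
  by move=> j; have [f Df fe] := Dd _ _ (basis_L2 j) eps0; exists f.
exists f; split=> [j|x x0 x_ae]; first by have [] := fP j.
have fL2 j : L2 mu (f j) by apply: DL2; have [] := fP j.
have [i0 xi0] : exists i0, x ord0 i0 != 0.
  apply: contrapT => no; move/negP: x0; apply; apply/eqP/rowP => i; rewrite mxE.
  by apply/eqP; apply: contrapT => /negP xi; apply: no; exists i.
(* Testing a vanishing combination against [e j], for the largest coefficient, gives |x_j| at most n
   / (n + 1) times |x_j|. *)
pose j := [arg max_(i > i0) `|x ord0 i|]%O.
have jmax i : `|x ord0 i| <= `|x ord0 j|.
  by rewrite /j; case: arg_maxP => // i' _ h; exact: h.
have xj0 : 0 < `|x ord0 j| by apply: lt_le_trans (jmax i0); rewrite normr_gt0.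
have b i : L2dot mu (f i) (e j) = (i == j)%:R + L2dot mu (f i - e i) (e j).
  have [i1 _] := L2dot_le (fL2 i) (basis_L2 j).
  have [i2 _] := L2dot_le (basis_L2 i) (basis_L2 j).
  have -> : L2dot mu (f i - e i) (e j) = L2dot mu (f i) (e j) - L2dot mu (e i) (e j).
    rewrite /L2dot -RintegralB//; apply: eq_Rintegral => y _.
    by rewrite -mulrBl.
  by rewrite eo; rewrite (inj_eq val_inj); ring.
have small i : `|L2dot mu (f i - e i) (e j)| <= n.+1%:R^-1.
  have fe2 : L2 mu (f i - e i).
    apply: LfunB; [by rewrite ler1n|exact: fL2|exact: basis_L2].
  have [_ h] := L2dot_le fe2 (basis_L2 j); apply: le_trans h _.
  by rewrite basis_norm mulr1 ltW//; have [] := fP i.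
have sumE : L2dot mu (\sum_i x ord0 i *: f i) (e j) = \sum_i x ord0 i * L2dot mu (f i) (e j).
  (* Integrability is carried along the induction, since the integral is additive only on integrable
     functions. *)
  pose lin (u : S -> R) r := itg mu (fun y : borel S => u y * e j y) /\ L2dot mu u (e j) = r.
  suff [] : lin (\sum_i x ord0 i *: f i) (\sum_i x ord0 i * L2dot mu (f i) (e j)) by [].
  apply: (big_rec2 lin); first split.
  - rewrite /itg (_ : EFin \o _ = cst 0%E); first exact: integrable0.
    by apply: funext => y /=; rewrite mul0r.
  - by rewrite /L2dot /Rintegral integral0_eq// => y _; rewrite mul0r.
  - move=> i u r _ [ui uE]; have [i1 _] := L2dot_le (fL2 i) (basis_L2 j).
    have e1 : (fun y : borel S => (x ord0 i *: f i + u) y * e j y) =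
        (fun y => x ord0 i * (f i y * e j y) + u y * e j y).
      apply: funext => y.
      by rewrite -[(x ord0 i *: f i + u) y]/(x ord0 i * f i y + u y); ring.
    rewrite /lin /L2dot e1; split; first exact: itgD (itgZ _ i1) ui.
    rewrite RintegralD//; last exact: (itgZ _ i1).
    by rewrite RintegralZl// -uE.
have zero : L2dot mu (\sum_i x ord0 i *: f i) (e j) = 0.
  have -> : L2dot mu (\sum_i x ord0 i *: f i) (e j) = Rintegral mu setT (cst 0 : borel S -> R).
    have uL : L2 mu (\sum_i x ord0 i *: f i).
      have qe : (1 <= 2%:E :> \bar R)%E by rewrite lee_fin ler1n.
      apply: (big_rec (fun u => L2 mu u)); first exact: (Lfun_submod_closed mu qe).1.
      by move=> i u _ uL; apply: (Lfun_submod_closed mu qe).2; [exact: fL2|exact: uL].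
    have mu1 := Lfun_measurable uL; have mu2 := Lfun_measurable (basis_L2 j).
    congr fine; apply: ae_eq_integral => //.
    - by apply/measurable_EFinP; exact: measurable_funM.
    - by apply/measurable_EFinP; exact: measurable_cst.
    apply: (@filterS _ _ (ae_filter_ringOfSetsType mu) _ _ _ x_ae) => y h _ /=.
    by rewrite h// mul0r.
  by rewrite Rintegral_cst// mul0r.
move: zero; rewrite sumE.
rewrite (eq_bigr (fun i => x ord0 i * (i == j)%:R +
   x ord0 i * L2dot mu (f i - e i) (e j))); last first.
  by move=> i _; rewrite b mulrDr.
rewrite big_split /= (bigD1 j)//= eqxx mulr1 big1 ?addr0; last first.
  by move=> i /negbTE ->; rewrite mulr0.
move=> /eqP; rewrite addr_eq0 => /eqP xE.
have : `|x ord0 j| <= n%:R * (`|x ord0 j| * n.+1%:R^-1).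
  rewrite [leLHS](_ : _ = `|\sum_i x ord0 i * L2dot mu (f i - e i) (e j)|); last first.
    by rewrite {1}xE normrN.
  apply: le_trans (ler_norm_sum _ _ _) _.
  rewrite -[n in n%:R]card_ord -sum1_card natr_sum mulr_suml ler_sum// => i _.
  by rewrite mul1r normrM ler_pM.
by rewrite mulrCA leNgt gtr_pMr// ltr_pdivrMr ?ltr0n// mul1r ltr_nat ltnSn.
Qed.

End Basis.

(** * Infinitely many weak solutions *)

Lemma even_mul_norm (R : realType) (l : nat) (z : R) : ~~ odd l -> z * `|z| ^+ l = z ^+ l.+1.
Proof.
by move=> /even_halfK <-; rewrite exprS -mul2n !exprM real_normK// num_real.
Qed.

Theorem corollary14 (R : realType) (S : ptopologicalType)
  (g : closed_surface R S)
  (mu : {measure set (borel S) -> \bar R}) (mu_volume : is_volume g mu)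
  (e : nat -> S -> R) (lam : nat -> R) (e_basis : eigenbasis g mu e lam)
  (d : measure_display) (Om : measurableType d) (P : probability Om R)
  (xi : Om -> (S -> R) -> R) (xi_noise : white_noise g mu P xi)
  (H : Om -> (S -> R) -> (S -> R) -> Prop)
  (H_anderson : anderson_operator g mu e lam P xi H)
  (H_closed_symmetric : {ae P, forall w, closed_symmetric mu (H w)})
  (H_compact_resolvent : {ae P, forall w, compact_resolvent mu (H w)})
  (H_invertible : {ae P, forall w, invertible mu (H w)})
  (c : {RV P >-> R})
  (Hc_positive : {ae P, forall w, shifted_positive mu (H w) (c w)})
  (E : Om -> set (S -> R)) (dot : Om -> (S -> R) -> (S -> R) -> R)
  (E_energy : {ae P, forall w, energy_space mu (H w) (E w) (dot w) (c w)})
  (E_sobolev : {ae P, forall w, forall b : R, 0 <= b < 1 ->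
     dense_in (E w) (sobolev mu e lam b) (sobolev_norm mu e lam b) /\
     compactly_included (E w) (sobolev mu e lam b)
       (norm_of (dot w)) (sobolev_norm mu e lam b)})
  (E_lebesgue : {ae P, forall w, forall q : R, 1 < q ->
     compactly_included (E w) (Leb mu q%:E) (norm_of (dot w)) (Lqnorm mu q)}) :
  {ae P, forall w, forall (l : nat) (p : \bar R) (a : S -> R),
     (0 < l)%N -> ~~ odd l -> (1 < p)%E -> Leb mu p a ->
     exists u : nat -> S -> R,
       (forall n, weak_solution mu (E w) (dot w) (c w) a
                    (fun _ z => z * `|z| ^+ l) (u n)) /\
       (forall m n, m <> n -> ~ eq_mu mu (u m) (u n))}.
Proof.
(* From here on the noise is fixed and the argument deterministic: one null set serves all [l], [p]
   and [a]. *)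
apply: filterS3 H_closed_symmetric E_energy E_lebesgue => w Hs HE Hq l p a l0 lev p1 ap.
have dom_E : op_dom (H w) `<=` E w by have [] := energy_dense HE.
have Einf n : exists f : 'I_n -> S -> R, (forall j, E w (f j)) /\
    forall x : 'rV[R]_n, x != 0 -> ~ eq_mu mu (\sum_j x ord0 j *: f j) (cst 0).
  have [f [Df fP]] := dense_independent e_basis n (op_dense Hs).
  by exists f; split => // j; exact: dom_E.
have E0 : E w 0.
  have [f [Ef _]] := Einf 1%N.
  by have := energy_linear HE (-1) (Ef ord0) (Ef ord0); rewrite scaleN1r addNr.
pose m := l./2.
have lE : l = m.*2 by rewrite even_halfK.
have m0 : (0 < m)%N by rewrite half_gt0; case: (l) l0 lev => [|[]].
(* Large energy is read as a large L^N norm: the mass to the power m is that norm to the power N m,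
   whence the level chosen below. *)
have sol beta : exists u, weak_solution mu (E w) (dot w) (c w) a (fun _ z => z * `|z| ^+ l) u /\
    beta < Nq mu m.*2.+2%:R u.
  have [v vE vb] := weak_high_energy HE Hq E0 Einf m0 p1 ap (1 + `|beta| ^+ (m.*2.+2 * m)).
  exists (vecval v); split.
    split=> [|v' Ev']; first exact: (vec_in v).
    rewrite -[RHS](_ : kform m v (@to_vec _ _ (energy HE E0) v' Ev') = _).
      exact: vE (@to_vec _ _ (energy HE E0) v' Ev').
    by apply: eq_Rintegral => x _; rewrite even_mul_norm// lE.
  rewrite (kform_mass Hq) -exprM in vb.
  have b0 : 0 < `|beta| ^+ (m.*2.+2 * m) + 1 by rewrite ltr_wpDl// exprn_ge0.
  apply: le_lt_trans (ler_norm beta) _.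
  rewrite ltNge; apply/negP => h.
  have := lerXn2r (m.*2.+2 * m)%N (Nq_ge0 mu m.*2.+2%:R (vecval v)) (normr_ge0 beta) h.
  lra.
have /choice[f fP] := sol.
(* Each solution has a larger L^N norm than the one before; since this norm depends only on the
   class almost everywhere, the solutions are pairwise distinct. *)
pose u := fix u n := if n is k.+1 then f (Nq mu m.*2.+2%:R (u k)) else f 0.
have uP n : weak_solution mu (E w) (dot w) (c w) a (fun _ z => z * `|z| ^+ l) (u n).
  by case: n => [|n]; [have [] := fP 0|have [] := fP (Nq mu m.*2.+2%:R (u n))].
have uS n : Nq mu m.*2.+2%:R (u n) < Nq mu m.*2.+2%:R (u n.+1).
  by have [] := fP (Nq mu m.*2.+2%:R (u n)).
exists u; split=> // i j ij uij.
have mono : {homo (fun n => Nq mu m.*2.+2%:R (u n)) : i j / (i < j)%N >-> i < j}.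
  by apply: homo_ltn => // x y z; exact: lt_trans.
have Nij : Nq mu m.*2.+2%:R (u i) = Nq mu m.*2.+2%:R (u j).
  have [Ei _] := uP i; have [Ej _] := uP j.
  have mui := energy_measurable Hq Ei; have muj := energy_measurable Hq Ej.
  rewrite /Nq unlock; congr (fine (_ `^ _)%E); apply: ae_eq_integral => //.
  - apply/measurable_EFinP; exact: measurable_powR_norm.
  - apply/measurable_EFinP; exact: measurable_powR_norm.
  - apply: (@filterS _ _ (ae_filter_ringOfSetsType mu) _ _ _ uij) => y h _ /=.
    by rewrite h.
by case: (ltngtP i j) => [/mono|/mono|/ij//]; rewrite Nij ltxx.
Qed.
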